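(* The sampling allocations made by Algorithm 3 satisfy the following almost surely: \[ \lim_{n \rightarrow \infty} \Big\{\left(\tfrac{\alpha_{i^b, n}(\theta_b)}{\lambda_{i^b}(\theta_b)}\right)^2 - \sum_{j \neq i^b}\left(\tfrac{\alpha_{j, n}(\theta_b)}{\lambda_j(\theta_b)}\right)^2\Big\} = 0, \forall\theta_b \mbox{ and } \lim_{n \rightarrow \infty}\tfrac{W^{\textup{ACC}}_{i}(\theta_b)G_{i ,n}(\theta_b)}{W^{\textup{ACC}}_{j}(\theta_c)G_{j, n}(\theta_c)} = 1, \forall (i, \theta_b), (j, \theta_c) \in \Xi\cup\Xi^{\textup{adv}}. \] Also, $\limsup_{n \rightarrow \infty} {N^n_i(\theta_b)}/{N^n_j(\theta_{b^\prime})} < \infty$ for all $(i, \theta_b) \neq (j, \theta_{b^\prime})$. For Algorithm 4, the same statements hold when $W^{\textup{ACC}}_{i}(\theta_b)$ is replaced with $W^{\textup{FN}}_{i}(\theta_b)$.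
   Context: Setting: $k$ solutions and an uncertain input parameter $\theta$ with finite support $\{\theta_1,\dots,\theta_B\}$ and probabilities $p_b>0$, $\sum_b p_b=1$. Let $y_i(\theta_b)$ be the mean simulation output of solution $i$ given $\theta_b$; the conditional optimum $i^b=\arg\min_i y_i(\theta_b)$ is assumed unique for each $b$, and the most probable best $i^*=\arg\max_i \sum_b p_b\mathbf 1\{i=i^b\}$ is assumed unique. Favorable set $\Theta_{i}=\{\theta_b: i^b=i\}$. Define $d_j=\sum_b p_b\mathbf 1\{i^*=i^b\}-\sum_b p_b\mathbf 1\{j=i^b\}$, $\Xi=\{(i,\theta_b): i\neq i^*, i\neq i^b\}$ and $\Xi^{\textup{adv}}=\{(i^*,\theta_b):\theta_b\notin\Theta_{i^*}\}$. For $(i,\theta_b)\in\Xi$, $W_i(\theta_b)=\max\{\min(\min_{j\neq i^*}d_j, d_i/2)/p_b,1\}$ if $\theta_b\in\Theta_{i^*}$ and $W_i(\theta_b)=\max\{d_i/p_b,1\}$ otherwise. Balance weights: $W^{\textup{ACC}}_i(\theta_b)=1$ if $\theta_b\in\Theta_{i^*}$ or $(i,\theta_b)\in\Xi^{\textup{adv}}$, and $=W_i(\theta_b)$ if $\theta_b\notin\Theta_{i^*}$ (with $(i,\theta_b)\in\Xi$); $W^{\textup{FN}}_i(\theta_b)=W_i(\theta_b)$ on $\Xi$ and $=1$ on $\Xi^{\textup{adv}}$; both are $\infty$ outside $\Xi\cup\Xi^{\textup{adv}}$. Simulation outputs $Y_i(\theta_b)$ are independent normal with mean $y_i(\theta_b)$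 and known variance $\lambda_i^2(\theta_b)$; with a noninformative normal prior the posterior mean $\mu_{i,n}(\theta_b)$ is the sample mean of the $N^n_i(\theta_b)$ replications allocated to $(i,\theta_b)$ after $n$ total replications, and $\alpha_{i,n}(\theta_b)=N^n_i(\theta_b)/n$. Sample rate $G_{i,n}(\theta_b)=(\mu_{i,n}(\theta_b)-\mu_{i_n^b,n}(\theta_b))^2/\big(2(\lambda_i^2(\theta_b)/\alpha_{i,n}(\theta_b)+\lambda_{i_n^b}^2(\theta_b)/\alpha_{i_n^b,n}(\theta_b))\big)$ for $i\neq i_n^b$. Algorithm 3: allocate $n_0$ initial replications to every $(i,\theta_b)$; then repeatedly: compute $\mu_{i,n}(\theta_b)$, $i_n^b=\arg\min_i\mu_{i,n}(\theta_b)$, $i_n^*=\arg\max_i\sum_b p_b\mathbf 1\{i=i_n^b\}$ (ties broken by choosing $\arg\max_{j}\min_{b:i_n^b\neq j}G_{j,n}(\theta_b)$ among tied $j$); form plug-in weights $W^{\textup{ACC}}_{i,n}(\theta_b)$ by replacing $i^b,i^*$ with $i_n^b,i_n^*$; find $(i,\theta_b)$ minimizing $W^{\textup{ACC}}_{i,n}(\theta_b)G_{i,n}(\theta_b)$; if $(N^n_{i_n^b}(\theta_b)/\lambda_{i_n^b}(\theta_b))^2<\sum_{j\neq i_n^b}(N^n_j(\theta_b)/\lambda_j(\theta_b))^2$ run a replication at $(i_n^b,\theta_b)$, otherwise at $(i,\theta_b)$. Algorithm 4 is identical with $W^{\textup{FN}}$ in place of $W^{\textup{ACC}}$. *)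

(* Defs.v *)
From HB Require Import structures.
From mathcomp Require Import all_boot all_order all_algebra.
From mathcomp Require Import all_classical all_reals all_analysis.
Set Implicit Arguments.
Unset Strict Implicit.
Unset Printing Implicit Defensive.
Import Order.TTheory GRing.Theory Num.Theory.
Import numFieldNormedType.Exports.
Local Open Scope classical_set_scope.
Local Open Scope ring_scope.

Definition mutually_independent {d} {Omega : measurableType d} {R : realType}
  (P : probability Omega R) {I : eqType} (X : I -> Omega -> R) : Prop :=
  forall (J : seq I) (A : I -> set R), uniq J -> (forall i, measurable (A i)) ->
    P (\bigcap_(i in [set` J]) (X i @^-1` A i)) =
    (\prod_(i <- J) P (X i @^-1` A i))%E.

Section Procedure.
Variables (R : realType) (k B : nat).
Variable p : 'I_B -> R.
Variable lam : 'I_k -> 'I_B -> R.       (* standard deviations lambda_i(theta_b) *)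

(* ----- quantities defined from a "conditional best" map ib : b |-> i^b
         and a "most probable best" istar ------------------------------ *)
Section Weights.
Variables (ib : 'I_B -> 'I_k) (istar : 'I_k).

Definition mass (j : 'I_k) : R := \sum_(b < B) (if ib b == j then p b else 0).
Definition dgap (j : 'I_k) : R := mass istar - mass j.
Definition inTheta (b : 'I_B) : bool := ib b == istar.
Definition inXi (i : 'I_k) (b : 'I_B) : bool := (i != istar) && (i != ib b).
Definition inXiadv (i : 'I_k) (b : 'I_B) : bool := (i == istar) && (ib b != istar).
(* (i, theta_b) \in Xi \cup Xi^adv  (the pairs with finite weight) *)
Definition inDom (i : 'I_k) (b : 'I_B) : bool := inXi i b || inXiadv i b.

(* W_i(theta_b) for (i,theta_b) in Xi.  The minimum  min_{j <> i*} d_j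
   is computed as a fold seeded with d_i; since (i,theta_b) \in Xi gives
   i <> i*, d_i is itself one of the d_j, so this is exactly min_{j<>i*} d_j. *)
Definition Wxi (i : 'I_k) (b : 'I_B) : R :=
  if inTheta b then
    Num.max (Num.min (\big[Num.min/dgap i]_(j | j != istar) dgap j) (dgap i / 2) / p b) 1
  else Num.max (dgap i / p b) 1.

(* balance weights; only meaningful on Xi \cup Xi^adv (they are +oo elsewhere,
   which is encoded by restricting to inDom wherever they are used). *)
Definition W_ACC (i : 'I_k) (b : 'I_B) : R :=
  if inTheta b || inXiadv i b then 1 else Wxi i b.
Definition W_FN (i : 'I_k) (b : 'I_B) : R :=
  if inXiadv i b then 1 else Wxi i b.

(* acc = true: W^ACC (Algorithm 3);  acc = false: W^FN (Algorithm 4) *)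
Definition Wrule (acc : bool) (i : 'I_k) (b : 'I_B) : R :=
  if acc then W_ACC i b else W_FN i b.
End Weights.

(* ----- empirical quantities, given the stream of simulation outputs
   obs i b m  (the m-th replication at (i,theta_b)) and the current
   allocation N i b = N^n_i(theta_b) ------------------------------------ *)
Section Empirical.
Variables (obs : 'I_k -> 'I_B -> nat -> R) (N : 'I_k -> 'I_B -> nat).

Definition total : nat := \sum_(i < k) \sum_(b < B) N i b.
Definition alpha (i : 'I_k) (b : 'I_B) : R := (N i b)%:R / (total)%:R.
(* posterior mean = sample mean of the N i b first replications *)
Definition mean (i : 'I_k) (b : 'I_B) : R :=
  (\sum_(m < N i b) obs i b m) / (N i b)%:R.

(* i_n^b : the first (smallest index) minimiser of the sample means *)
Definition ebest (b : 'I_B) : option 'I_k :=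
  [pick i | [forall j, mean i b <= mean j b]].
(* i_n^b as a total function, with an (irrelevant, since k >= 1) default *)
Definition ebestd (x0 : 'I_k) (b : 'I_B) : 'I_k := odflt x0 (ebest b).

(* G_{i,n}(theta_b) (default x0 only used if the argmin were undefined) *)
Definition Gx (x0 : 'I_k) (i : 'I_k) (b : 'I_B) : R :=
  let j := ebestd x0 b in
  (mean i b - mean j b) ^+ 2 /
  (2 * (lam i b ^+ 2 / alpha i b + lam j b ^+ 2 / alpha j b)).
Definition G (i : 'I_k) (b : 'I_B) : R := Gx i i b.

(* i_n^*: maximiser of the empirical mass; ties broken by
   argmax_j min_{b : i_n^b <> j} G_{j,n}(theta_b); remaining ties by index. *)
Definition escore (x0 j : 'I_k) : \bar R :=
  \big[Order.min/+oo%E]_(b | ebestd x0 b != j) (Gx x0 j b)%:E.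
Definition emaxer (x0 j : 'I_k) : bool :=
  [forall j', mass (ebestd x0) j' <= mass (ebestd x0) j].
Definition estar (x0 : 'I_k) : option 'I_k :=
  [pick j | emaxer x0 j && [forall j', emaxer x0 j' ==> (escore x0 j' <= escore x0 j)%E]].
Definition estard (x0 : 'I_k) : 'I_k := odflt x0 (estar x0).

Definition eW (acc : bool) (i : 'I_k) (b : 'I_B) : R :=
  Wrule (ebestd i) (estard i) acc i b.
Definition eDom (i : 'I_k) (b : 'I_B) : bool :=
  inDom (ebestd i) (estard i) i b.

(* the pair minimising W_{i,n}(theta_b) G_{i,n}(theta_b) over the pairs of
   finite plug-in weight (first one in enumeration order in case of ties) *)
Definition esel (acc : bool) : option ('I_k * 'I_B) :=
  [pick x : 'I_k * 'I_B | eDom x.1 x.2 &&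
     [forall y : 'I_k * 'I_B, eDom y.1 y.2 ==>
        (eW acc x.1 x.2 * G x.1 x.2 <= eW acc y.1 y.2 * G y.1 y.2)]].

Definition incr (i : 'I_k) (b : 'I_B) : 'I_k -> 'I_B -> nat :=
  fun j c => (N j c + ((j == i) && (c == b)))%N.

Definition step (acc : bool) : 'I_k -> 'I_B -> nat :=
  match esel acc with
  | Some (i, b) =>
      let j := ebestd i b in
      if ((N j b)%:R / lam j b) ^+ 2 < \sum_(j' | j' != j) ((N j' b)%:R / lam j' b) ^+ 2
      then incr j b else incr i b
  | None => N
  end.
End Empirical.

Fixpoint run (acc : bool) (n0 : nat) (obs : 'I_k -> 'I_B -> nat -> R) (t : nat)
  : 'I_k -> 'I_B -> nat :=
  match t with
  | 0 => fun _ _ => n0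
  | t'.+1 => step obs (run acc n0 obs t') acc
  end.

End Procedure.

(* Main.v *)
(** Almost surely, the sample means converge, and infinitely often the sample
mean of a given pair overshoots its limit by an arbitrary multiple of
[1 / sqrt n] more than the means of the other solutions ever do again at
comparable or larger counts. If some pair were sampled finitely often, the minimum
of [n W G], for [n] the total number of replications, would stay bounded; then a
pair [(i, b)] with [N] replications is sampled only if some [j <> i] has a
comparable count and a sample mean not smaller than that of [i] by more than
[O(1 / sqrt N)]. For [i] of largest mean among those sampled infinitely often at
[b], the overshoots of [i] contradict this.

Hence every count tends to infinity and the plug-in quantities are eventually
correct. The balance test keeps the two sums of squares asymptotically equal.
Between two samplings of a suboptimal pair, the count of the best solution grows
by a factor close to 1, so the weighted rate of a pair stays close to the minimum
at which it was last selected. *)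

Require Import Defs.
From HB Require Import structures.
From mathcomp Require Import all_boot all_order all_algebra.
From mathcomp Require Import all_classical all_reals all_analysis.
From mathcomp Require Import measurable_realfun ring lra zify.
Import Order.TTheory GRing.Theory Num.Theory.
Import numFieldNormedType.Exports.
Local Open Scope classical_set_scope.
Local Open Scope ring_scope.

(** * Normal distributions *)

(** Probability enters only through the strong law and [ae_dominating]. Neither refers to the
    allocation, so both apply at the random counts that the algorithm produces, and all the rest is
    a deterministic argument for one fixed outcome. The strong law alone does not exclude neglect.
    Only [i^b] is assumed unique: if the sample mean of the true best is frozen at a bad early
    value, two other solutions with equal means might be compared forever, since a gap of order
    [1 / sqrt N] is the size of their ordinary fluctuations. Hence the need for arbitrarily large
    multiples of [1 / sqrt n], reached while the competing streams, whose counts are known only up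
    to a constant factor, stay quiet; independence of the streams provides this. The factor [n] in
    [n W G] cancels the total hidden in [alpha]: a rate then involves only the counts at one
    context, and a neglected pair keeps a variance term bounded below, which is why the minimum
    stays bounded. *)

Section NormalDistribution.
Context {R : realType}.
Implicit Types (m s x z : R) (A : set R).
Local Notation mu := (@lebesgue_measure R).

(** The density is a Radon-Nikodym derivative of the law. Passing to Lebesgue measure yields
    iterated integrals to which Tonelli's theorem applies. *)
Lemma integral_normal_prob m s (f : R -> \bar R) :
  measurable_fun setT f ->
  (forall x, 0 <= f x)%E -> (\int[normal_prob m s]_x f x < +oo)%E ->
  (\int[normal_prob m s]_x f x = \int[mu]_x (f x * (normal_pdf m s x)%:E))%E.
Proof.
move=> mf f0 fy.
have dom : normal_prob m s `<< mu by exact: normal_prob_dominates.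
have mpdf : measurable_fun setT (fun x => (normal_pdf m s x)%:E).
  by apply/measurable_EFinP; exact: measurable_normal_pdf.
rewrite -(Radon_Nikodym_change_of_variables dom)//=; last first.
  by apply/integrableP; split => //; under eq_integral do rewrite gee0_abs//.
apply: ae_eq_integral => //.
- by apply: emeasurable_funM => //; apply: (measurable_int mu).
- exact: emeasurable_funM.
- apply: ae_eqe_mul2l => /=.
  rewrite Radon_NikodymE//=; case: cid => /= h [h1 h2 h3].
  apply: integral_ae_eq => //=.
  by move=> E ET mE; rewrite -h3.
Qed.

Lemma lebesgue_measure_shift (c : R) A : measurable A ->
  mu ((fun x => x + c) @^-1` A) = mu A.
Proof.
have mphi : measurable_fun setT (fun x : measurableTypeR R => (x + c : measurableTypeR R)).
  exact: measurable_funD.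
move=> mA; symmetry.
apply: (@lebesgue_measure_unique R (pushforward mu (fun x : measurableTypeR R => (x + c : measurableTypeR R)))) => //.
move=> _ [[a b] _ <-] /=; rewrite /pushforward.
rewrite (_ : _ @^-1` _ = `]a - c, b - c]%classic); last first.
  by apply/seteqP; split=> x /=; rewrite !in_itv/= ltrBlDr lerBrDr.
rewrite !lebesgue_measure_itv/= !lte_fin ltrD2r.
by case: ifP => // _; rewrite -!EFinD; congr EFin; lra.
Qed.

Lemma normal_prob_shift m s c A : measurable A ->
  normal_prob m s ((fun x => c + x) @^-1` A) =
  (\int[mu]_(z in A) (normal_pdf m s (z - c))%:E)%E.
Proof.
move=> mA; rewrite /normal_prob.
pose phi := (fun x : measurableTypeR R => (x + c : measurableTypeR R)).
have mphi : measurable_fun setT phi by exact: measurable_funD.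
have mf : measurable_fun setT (fun z : measurableTypeR R => (normal_pdf m s (z - c))%:E).
  apply/measurable_EFinP; apply: measurableT_comp; first exact: measurable_normal_pdf.
  exact: measurable_funB.
transitivity (\int[pushforward mu phi]_(z in A) (normal_pdf m s (z - c))%:E)%E; last first.
  by apply: eq_measure_integral => B mB _; rewrite /= /pushforward lebesgue_measure_shift.
rewrite ge0_integral_pushforward//; last 2 first.
- exact: measurable_funTS.
- by move=> z _; rewrite lee_fin normal_pdf_ge0.
rewrite (_ : phi @^-1` A = [set x | A (c + x)]); last first.
  by apply/seteqP; split => x /=; rewrite /phi addrC.
by apply: eq_integral => x _; rewrite /= /phi addrK.
Qed.

Lemma normal_peakE s : 0 < s -> normal_peak s = s^-1 * (Num.sqrt (pi *+ 2))^-1.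
Proof.
move=> s0; rewrite /normal_peak -mulrnAr sqrtrM ?sqr_ge0// sqrtr_sqr gtr0_norm//.
by rewrite invfM.
Qed.

(** Completing the square in [x]. The last factor is the density of the first summand conditioned on
    the sum being [z], so integrating over [x] leaves the density of the sum. *)
Lemma normal_pdfM m1 s1 m2 s2 s x z : 0 < s1 -> 0 < s2 -> 0 < s ->
  s ^+ 2 = s1 ^+ 2 + s2 ^+ 2 ->
  normal_pdf m1 s1 x * normal_pdf m2 s2 (z - x) =
  normal_pdf (m1 + m2) s z *
  normal_pdf (m1 + s1 ^+ 2 / s ^+ 2 * (z - m1 - m2)) (s1 * s2 / s) x.
Proof.
move=> s10 s20 s0 sE.
have t0 : 0 < s1 * s2 / s by rewrite divr_gt0 ?mulr_gt0.
rewrite !normal_pdfE ?gt_eqF//= !normal_peakE// mulrACA [RHS]mulrACA.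
congr (_ * _).
  set c := (Num.sqrt _)^-1; rewrite -![_ * c * _]mulrA !invfM invrK.
  by field; rewrite !gt_eqF.
rewrite /normal_fun -!expRD; congr expR.
have e1 : s1 ^+ 2 = s ^+ 2 - s2 ^+ 2 by rewrite sE addrK.
field: e1.
by rewrite !gt_eqF.
Qed.

End NormalDistribution.

Section NormalConvolution.
Context {R : realType}.
Implicit Types (m s x z : R) (A : set R).
Local Notation mu := (@lebesgue_measure R).

Let mpdf (D : set R) m s : measurable_fun D (fun x => (normal_pdf m s x)%:E).
Proof.
by apply: measurable_funTS; apply/measurable_EFinP; exact: measurable_normal_pdf.
Qed.

Let integral_indicM A (f : R -> R) : measurable A ->
  (\int[mu]_(z in A) (f z)%:E = \int[mu]_z (\1_A z * f z)%:E)%E.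
Proof.
move=> mA; rewrite integral_mkcond; apply: eq_integral => z _.
by rewrite patchE indicE; case: ifP => _; rewrite ?mul1r ?mul0r.
Qed.

(** After Tonelli, [normal_pdfM] leaves an inner density of integral 1. The left side is the form to
    which the product measure of the event unfolds in [normal_add_indep]. *)
Lemma normal_prob_conv m1 s1 m2 s2 s A : 0 < s1 -> 0 < s2 -> 0 < s ->
  s ^+ 2 = s1 ^+ 2 + s2 ^+ 2 -> measurable A ->
  (\int[normal_prob m1 s1]_x normal_prob m2 s2 ((fun y => x + y)%R @^-1` A) =
   normal_prob (m1 + m2) s A)%E.
Proof.
move=> s10 s20 s0 sE mA.
pose F (u : R * R) : \bar R := (\1_A u.2 * normal_pdf m2 s2 (u.2 - u.1))%:E.
have mF : measurable_fun setT F.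
  apply/measurable_EFinP; apply: measurable_funM.
    by apply: measurableT_comp; [exact: measurable_indic|exact: measurable_snd].
  apply: measurableT_comp; first exact: measurable_normal_pdf.
  by apply: measurable_funB; [exact: measurable_snd|exact: measurable_fst].
have F0 u : (0 <= F u)%E by rewrite lee_fin mulr_ge0// normal_pdf_ge0.
pose g x := (\int[mu]_z F (x, z))%E.
have gE x : normal_prob m2 s2 ((fun y => x + y)%R @^-1` A) = g x.
  by rewrite normal_prob_shift// integral_indicM.
have g0 x : (0 <= g x)%E by apply: integral_ge0.
have g1 x : (g x <= 1)%E.
  rewrite -gE; apply: probability_le1.
  rewrite -[X in measurable X]setTI.
  apply: (_ : measurable_fun setT (fun y => x + y)) => //.
  exact: measurable_funD.
have mg : measurable_fun setT g by exact: measurable_fun_fubini_tonelli_F.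
under eq_integral do rewrite gE.
rewrite integral_normal_prob//; last first.
  apply: (@le_lt_trans _ _ (\int[normal_prob m1 s1]_x (cst 1 x))%E).
    by apply: ge0_le_integral.
  by rewrite integral_cst//= mul1e probability_setT ltry.
pose H (u : R * R) : \bar R := (F u * (normal_pdf m1 s1 u.1)%:E)%E.
have mH : measurable_fun setT H.
  apply: emeasurable_funM => //; apply/measurable_EFinP.
  by apply: measurableT_comp; [exact: measurable_normal_pdf|exact: measurable_fst].
have H0 u : (0 <= H u)%E by rewrite mule_ge0// lee_fin normal_pdf_ge0.
transitivity (\int[mu]_x \int[mu]_z H (x, z))%E.
  apply: eq_integral => x _; rewrite -ge0_integralZr//.
  - by apply: measurableT_comp => //; exact: pair1_measurable.
  - by rewrite lee_fin normal_pdf_ge0.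
transitivity (\int[mu]_z \int[mu]_x H (x, z))%E.
  exact: (@fubini_tonelli _ _ _ _ _ mu mu H mH H0).
rewrite /normal_prob integral_indicM//; apply: eq_integral => z _.
pose q x := normal_pdf (m1 + s1 ^+ 2 / s ^+ 2 * (z - m1 - m2)) (s1 * s2 / s) x.
transitivity (\int[mu]_x ((\1_A z * normal_pdf (m1 + m2) s z)%:E * (q x)%:E))%E.
  apply: eq_integral => x _; rewrite /H /F /= -!EFinM; congr EFin.
  by rewrite -!mulrA; congr (_ * _); rewrite mulrC (@normal_pdfM R m1 s1 m2 s2 s).
rewrite ge0_integralZl//.
- by rewrite integral_normal_pdf mule1.
- exact: mpdf.
- by move=> x _; rewrite lee_fin normal_pdf_ge0.
- by rewrite lee_fin mulr_ge0// normal_pdf_ge0.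
Qed.

(* Comparison with the density of standard deviation 2 s replaces the second moment. *)
Lemma normal_prob_tail m s (a : R) : 0 < s -> 0 < a ->
  (normal_prob m s [set x | (a <= `|x - m|)%R] <= (6 * s ^+ 2 / a ^+ 2)%:E)%E.
Proof.
move=> s0 a0.
have mA : measurable [set x : R | (a <= `|x - m|)%R].
  rewrite (_ : [set _ | _] = (fun x => `|x - m|) @^-1` `[a, +oo[); last first.
    by apply/seteqP; split => x /=; rewrite in_itv/= andbT.
  rewrite -[X in measurable X]setTI.
  apply: (_ : measurable_fun setT (fun x : R => `|x - m|)) => //.
  by apply: measurableT_comp => //; exact: measurable_funB.
have s20 : 0 < 2 * s by rewrite mulr_gt0.
pose c := 6 * s ^+ 2 / a ^+ 2.
have c0 : 0 <= c by rewrite /c divr_ge0 ?sqr_ge0 // mulr_ge0 ?sqr_ge0 ?ler0n.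
(* With [z] the squared standardised distance, the ratio of the densities is
   [2 * expR (- (3 / 8 * z))]. The bounds [expR (- u) <= u^-1] and [1 / 3 <= 3 / 8] give the factor
   [2 * 3 = 6]. *)
have key x : a <= `|x - m| -> normal_pdf m s x <= c * normal_pdf m (2 * s) x.
  move=> ax; rewrite !normal_pdfE ?gt_eqF//= !normal_peakE//.
  set k := (Num.sqrt _)^-1.
  have k0 : 0 <= k by rewrite invr_ge0.
  set z := (x - m) ^+ 2 / s ^+ 2.
  have az : a ^+ 2 / s ^+ 2 <= z.
    by rewrite /z ler_pM2r ?invr_gt0 ?exprn_gt0// -[leRHS]real_normK ?num_real// lerXn2r ?nnegrE ?normr_ge0// ltW.
  have z0 : 0 < z by apply: lt_le_trans az; rewrite divr_gt0 ?exprn_gt0.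
  have -> : normal_fun m s x = expR (- (3 / 8 * z)) * normal_fun m (2 * s) x.
    rewrite /normal_fun -expRD; congr expR; rewrite /z.
    by field; rewrite gt_eqF.
  have z38 : 0 < 3 / 8 * z by lra.
  have e8 : expR (- (3 / 8 * z)) <= (3 / 8 * z)^-1.
    rewrite expRN lef_pV2 ?posrE ?expR_gt0//.
    by apply: le_trans (expR_ge1Dx _); rewrite lerDr.
  have e9 : (3 / 8 * z)^-1 <= 3 * s ^+ 2 / a ^+ 2.
    have -> : 3 * s ^+ 2 / a ^+ 2 = (1/3 * (a ^+ 2 / s ^+ 2))^-1.
      by field; rewrite !gt_eqF.
    rewrite lef_pV2 ?posrE; [|lra|by rewrite mulr_gt0 ?divr_gt0 ?exprn_gt0].
    lra.
  have -> : s^-1 * k * (expR (- (3 / 8 * z)) * normal_fun m (2 * s) x) =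
            (2 * expR (- (3 / 8 * z))) * ((2 * s)^-1 * k * normal_fun m (2 * s) x).
    by field; rewrite gt_eqF.
  apply: ler_wpM2r.
    by rewrite !mulr_ge0// ?invr_ge0 ?normal_fun_ge0// ltW.
  rewrite /c; lra.
apply: (@le_trans _ _ (\int[mu]_(x in [set x : R | (a <= `|x - m|)%R]) (c%:E * (normal_pdf m (2 * s) x)%:E))%E).
  apply: ge0_le_integral => //=.
  - by move=> x _; rewrite lee_fin normal_pdf_ge0.
  - exact: mpdf.
  - by apply: emeasurable_funM => //; exact: mpdf.
rewrite ge0_integralZl//; last 2 first.
- exact: mpdf.
- by move=> x _; rewrite lee_fin normal_pdf_ge0.
rewrite -[leRHS]mule1; apply: lee_wpmul2l; first by rewrite lee_fin.
rewrite -[X in (X <= _)%E]/(normal_prob m (2 * s) [set x : R | (a <= `|x - m|)%R]).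
exact: probability_le1.
Qed.

(** On an interval of length [s] the density is at least its value at the far end, of order [s^-1].
    The scale cancels, so [e] depends on [K] only. *)
Lemma normal_prob_upper (K : R) : 0 <= K -> exists2 e : R, 0 < e &
  forall m s, 0 < s -> (e%:E <= normal_prob m s [set x | (m + K * s <= x)%R])%E.
Proof.
move=> K0; pose e := (Num.sqrt (pi *+ 2))^-1 * expR (- ((K + 1) ^+ 2 / 2)) : R.
exists e; first by rewrite mulr_gt0 ?expR_gt0// invr_gt0 sqrtr_gt0 mulrn_wgt0// pi_gt0.
move=> m s s0.
pose I : set R := `[m + K * s, m + (K + 1) * s]%classic.
have mI : measurable I by exact: measurable_itv.
apply: (@le_trans _ _ (\int[mu]_(x in I) (cst (s^-1 * e)%:E x))%E).
  rewrite integral_cst//= lebesgue_measure_itv/= lte_fin ltrD2l ltr_pM2r//.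
  rewrite ltrDl ltr01 -EFinB -EFinM lee_fin.
  suff -> : s^-1 * e * (m + (K + 1) * s - (m + K * s)) = e by [].
  by field; rewrite gt_eqF.
apply: (@le_trans _ _ (normal_prob m s I)).
  apply: ge0_le_integral => //=.
  - move=> x _; rewrite lee_fin !mulr_ge0// ?invr_ge0 ?expR_ge0// ltW//.
  - exact: mpdf.
  move=> x; rewrite /I /= in_itv/= => /andP[x1 x2]; rewrite lee_fin.
  rewrite normal_pdfE ?gt_eqF//= normal_peakE// /e mulrA ler_wpM2l//.
    by rewrite mulr_ge0// invr_ge0// ltW.
  rewrite /normal_fun ler_expR mulNr lerN2 ler_pdivrMr; last by rewrite pmulrn_lgt0// exprn_gt0.
  have : (x - m) ^+ 2 <= ((K + 1) * s) ^+ 2.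
    have Ks : 0 <= K * s by rewrite mulr_ge0// ltW.
    have x0 : 0 <= x - m by lra.
    by rewrite lerXn2r ?nnegrE//; lra.
  rewrite exprMn => h; rewrite -mulr_natr; lra.
apply: le_measure; rewrite ?inE//.
  rewrite (_ : [set _ | _] = `[m + K * s, +oo[%classic)//.
  by apply/seteqP; split => x /=; rewrite in_itv/= andbT.
by move=> x; rewrite /I /= in_itv/= => /andP[].
Qed.

End NormalConvolution.

(** * Independence and sums of normal variables *)

Section Independence.
Set Implicit Arguments.
Unset Strict Implicit.
Context {d : measure_display} {Omega : measurableType d} {R : realType}.
Variables (P : probability Omega R) (I : eqType) (X : I -> Omega -> R).
Implicit Types (J : set I) (E F : set Omega).

(** A pi-system: [J] may be infinite, but each event constrains finitely many variables. *)
Definition cylinder J : set (set Omega) :=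
  [set E | exists (s : seq I) (A : I -> set R),
    [/\ uniq s, [set` s] `<=` J, forall i, measurable (A i) &
        E = \bigcap_(i in [set` s]) (X i @^-1` A i)]].

(** The type [Omega] with a smaller sigma-algebra, so that [measurable_fun] out of [sigma_of J]
    expresses dependence on the variables in [J] alone. *)
Definition sigma_of J : measurableType _ := g_sigma_algebraType (cylinder J).

Lemma cylinderI J : setI_closed (cylinder J).
Proof.
move=> _ _ [s [A [us sJ mA ->]]] [t [B [ut tJ mB ->]]].
pose C (i : I) : set R := (if i \in s then A i else setT) `&` (if i \in t then B i else setT).
exists (undup (s ++ t)), C; split => //.
- exact: undup_uniq.
- move=> i; rewrite /= mem_undup mem_cat => /orP[/sJ|/tJ]//.
- by move=> i; apply: measurableI; case: ifP.
apply/seteqP; split => w.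
  move=> [ws wt] i; rewrite /= mem_undup mem_cat => _; rewrite /C; split.
    by case: ifPn => // /ws.
  by case: ifPn => // /wt.
move=> wC; split => i /= ist.
  have /= := wC i; rewrite mem_undup mem_cat ist => /(_ isT)[+ _].
  by rewrite /= ist.
have /= := wC i; rewrite mem_undup mem_cat ist orbT => /(_ isT)[_].
by rewrite /= ist.
Qed.

Lemma cylinder1 J i (A : set R) : J i -> measurable A -> cylinder J (X i @^-1` A).
Proof.
move=> Ji mA; exists [:: i], (fun=> A); split => //.
  by move=> j; rewrite /= inE => /eqP ->.
apply/seteqP; split => w /=; first by move=> Aw j /=; rewrite inE => /eqP ->.
by move=> /(_ i); apply; rewrite /= inE.
Qed.

Lemma sigma_of_sub J J' E : J `<=` J' ->
  @measurable _ (sigma_of J) E -> @measurable _ (sigma_of J') E.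
Proof.
move=> JJ'; apply: smallest_sub; first exact: smallest_sigma_algebra.
move=> F [s [A [us sJ mA ->]]]; apply: sub_sigma_algebra.
by exists s, A; split => //; exact: subset_trans JJ'.
Qed.

Lemma sigma_of_var J i : J i -> measurable_fun setT (X i : sigma_of J -> R).
Proof.
move=> Ji _ A mA; rewrite setTI; apply: sub_sigma_algebra; exact: cylinder1.
Qed.

Hypothesis mX : forall i, measurable_fun setT (X i).

Lemma sigma_of_measurable J E : @measurable _ (sigma_of J) E -> measurable E.
Proof.
apply: smallest_sub; first exact: sigma_algebra_measurable.
move=> F [s [A [us sJ mA ->]]]; apply: fin_bigcap_measurable => // i _.
rewrite -[X in measurable X]setTI; exact: mX.
Qed.

Hypothesis indX : mutually_independent P X.

(** Dynkin's argument: independence from a fixed event passes from a pi-system to the sigma-algebra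
    that it generates. *)
Let indep_lambda F : measurable F ->
  lambda_system setT [set E | measurable E /\ P (E `&` F) = (P E * P F)%E].
Proof.
move=> mF; apply/dynkin_lambda_system; split.
- by split => //; rewrite setTI probability_setT mul1e.
- move=> E [mE EF]; split; first exact: measurableC.
  have -> : ~` E `&` F = F `\` E by rewrite setDE setIC.
  have Foo : (P F < +oo)%E by rewrite (le_lt_trans (probability_le1 _ _))// ltry.
  have -> : P (F `\` E) = (P F - P (E `&` F))%E by rewrite (measureD mF mE Foo) (setIC F E).
  rewrite EF (probability_setC P mE).
  have /fineK <- := fin_num_measure P _ mE.
  have /fineK <- := fin_num_measure P _ mF.
  by rewrite -!EFinM -!EFinB; congr EFin; ring.
- move=> A tA AF; have mA n : measurable (A n) by case: (AF n).
  split; first exact: bigcup_measurable.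
  rewrite setI_bigcupl.
  have -> : P (\bigcup_n (A n `&` F)) = (\sum_(n <oo) P (A n `&` F))%E.
    apply: measure_semi_bigcup.
    - by move=> n; exact: measurableI.
    - exact: trivIset_setIr.
    - by apply: bigcup_measurable => n _; exact: measurableI.
  have -> : P (\bigcup_n A n) = (\sum_(n <oo) P (A n))%E.
    by apply: measure_semi_bigcup => //; exact: bigcup_measurable.
  have /fineK PF := fin_num_measure P _ mF.
  rewrite muleC -PF -nneseriesZl//; apply: eq_eseriesr => n _.
  by rewrite PF; case: (AF n) => _ ->; rewrite muleC.
Qed.

Let cylinder_measurable J E : cylinder J E -> measurable E.
Proof. by move=> JE; apply: (@sigma_of_measurable J); exact: sub_sigma_algebra. Qed.

Let cylinder_indep J J' E F : J `&` J' = set0 -> cylinder J E -> cylinder J' F ->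
  P (E `&` F) = (P E * P F)%E.
Proof.
move=> JJ0 [s [A [us sJ mA ->]]] [t [B [ut tJ mB ->]]].
pose C (i : I) : set R := if i \in s then A i else B i.
have st i : i \in t -> i \notin s.
  by move=> it; apply/negP => si; have : (J `&` J') i; [split; [exact: sJ|exact: tJ]|rewrite JJ0].
have mC i : measurable (C i) by rewrite /C; case: ifP.
have -> : \bigcap_(i in [set` s]) (X i @^-1` A i) = \bigcap_(i in [set` s]) (X i @^-1` C i).
  by apply: eq_bigcapr => i /= si; rewrite /C si.
have -> : \bigcap_(i in [set` t]) (X i @^-1` B i) = \bigcap_(i in [set` t]) (X i @^-1` C i).
  by apply: eq_bigcapr => i /= ti; rewrite /C (negbTE (st _ ti)).
have -> : \bigcap_(i in [set` s]) (X i @^-1` C i) `&` \bigcap_(i in [set` t]) (X i @^-1` C i) =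
          \bigcap_(i in [set` s ++ t]) (X i @^-1` C i).
  rewrite -bigcap_setU; congr (\bigcap_(i in _) _).
  by apply/seteqP; split => i /=; rewrite mem_cat; [move=> [->//|->]; rewrite orbT|move=> /orP].
rewrite !indX// ?big_cat// cat_uniq us ut andbT /=.
by apply/hasPn => i /st.
Qed.

(** Two rounds of the pi-lambda theorem: the first event is freed while the second is still a
    cylinder, then the second is freed against an arbitrary first one. *)
Lemma sigma_of_indep J J' E F : J `&` J' = set0 ->
  @measurable _ (sigma_of J) E -> @measurable _ (sigma_of J') F ->
  P (E `&` F) = (P E * P F)%E.
Proof.
move=> JJ0 mE mF.
have EF' F' : cylinder J' F' -> P (E `&` F') = (P E * P F')%E.
  move=> cF'; have mF' := cylinder_measurable cF'.
  suff : [set E | measurable E /\ P (E `&` F') = (P E * P F')%E] E by case.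
  apply: (lambda_system_subset (@cylinderI J) (indep_lambda mF')) mE => //.
  move=> E' cE' /=; split; first exact: cylinder_measurable cE'.
  exact: cylinder_indep cE' cF'.
suff : [set F | measurable F /\ P (F `&` E) = (P F * P E)%E] F.
  by case=> _; rewrite setIC muleC.
have mE' := sigma_of_measurable mE.
apply: (lambda_system_subset (@cylinderI J') (indep_lambda mE')) mF => //.
move=> F' cF' /=; split; first exact: cylinder_measurable cF'.
by rewrite setIC muleC EF'.
Qed.

End Independence.

Section NormalSums.
Set Implicit Arguments.
Unset Strict Implicit.
Context {d : measure_display} {Omega : measurableType d} {R : realType}.
Variables (P : probability Omega R) (I : eqType) (X : I -> Omega -> R).
Hypothesis mX : forall i, measurable_fun setT (X i).
Hypothesis indX : mutually_independent P X.

Local Notation sig := (sigma_of X).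

Lemma measurable_sigma_of J (f : Omega -> R) :
  measurable_fun setT (f : sig J -> R) -> measurable_fun setT f.
Proof.
move=> mf _ A mA; rewrite setTI; apply: (sigma_of_measurable mX (J := J)).
by rewrite -[X in measurable X]setTI; exact: mf.
Qed.

(** Independence gives the joint law on rectangles, hence everywhere by uniqueness of the product
    measure; the law of the sum is then a convolution. *)
Lemma normal_add_indep (J J' : set I) (f g : Omega -> R) (m1 s1 m2 s2 s : R) (A : set R) :
  J `&` J' = set0 ->
  measurable_fun setT (f : sig J -> R) -> measurable_fun setT (g : sig J' -> R) ->
  (forall B, measurable B -> P (f @^-1` B) = normal_prob m1 s1 B) ->
  (forall B, measurable B -> P (g @^-1` B) = normal_prob m2 s2 B) ->
  0 < s1 -> 0 < s2 -> 0 < s -> s ^+ 2 = s1 ^+ 2 + s2 ^+ 2 ->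
  measurable A ->
  P ((f \+ g) @^-1` A) = normal_prob (m1 + m2) s A.
Proof.
move=> JJ0 mf mg lf lg s10 s20 s0 sE mA.
pose T := measurableTypeR R.
pose h w : T * T := (f w, g w).
have mh : measurable_fun setT h.
  by apply/measurable_fun_pairP; split; [exact: (measurable_sigma_of mf)|exact: (measurable_sigma_of mg)].
pose B := [set u : T * T | A (u.1 + u.2)].
have mB : measurable B.
  rewrite -[X in measurable X]setTI.
  apply: (_ : measurable_fun setT (fun u : T * T => (u.1 : R) + u.2)) => //.
  by apply: measurable_funD; [exact: measurable_fst|exact: measurable_snd].
rewrite (_ : _ @^-1` A = h @^-1` B)//.
rewrite -(normal_prob_conv m1 s1 m2 s2 s A)//.
transitivity ((normal_prob m1 s1 \x normal_prob m2 s2)%E B); last first.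
  rewrite /product_measure1; apply: eq_integral => x _ /=.
  by congr (normal_prob m2 s2 _); apply/seteqP; split => y; rewrite /xsection/= in_setE.
symmetry; rewrite -[RHS]/(pushforward P h B).
pose hM : {mfun Omega >-> (T * T)%type} := HB.pack h (isMeasurableFun.Build _ _ _ _ h mh).
have key := @product_measure_unique _ _ _ _ R (normal_prob m1 s1) (normal_prob m2 s2) (pushforward P hM).
apply: key => //.
move=> C D mC mD; transitivity (P (f @^-1` C) * P (g @^-1` D))%E; last by rewrite (lf C mC) (lg D mD).
rewrite -(sigma_of_indep mX indX JJ0).
- by [].
- by rewrite -[X in measurable X]setTI; exact: mf.
- by rewrite -[X in measurable X]setTI; exact: mg.
Qed.

Variables (idx : nat -> I) (y lam : R).
Hypothesis idx_inj : injective idx.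
Hypothesis lam0 : 0 < lam.
Hypothesis lawX : forall m (A : set R), measurable A ->
  P (X (idx m) @^-1` A) = normal_prob y lam A.

Definition block a b : set I := [set idx m | m in [set m | (a <= m < b)%N]].

Definition csum a b (w : Omega) : R := \sum_(a <= m < b) (X (idx m) w - y).

Lemma block_disj a b c e : (b <= c)%N -> block a b `&` block c e = set0.
Proof.
move=> bc; rewrite -subset0 => _ [[m /= /andP[_ mb] <-] [n /andP[cn _]]] /idx_inj nm.
by move: cn; rewrite nm leqNgt (leq_trans mb bc).
Qed.

Lemma block_sub a b a' b' : (a' <= a)%N -> (b <= b')%N -> block a b `<=` block a' b'.
Proof.
move=> aa bb _ [m /= /andP[am mb] <-]; exists m => //=.
by rewrite (leq_trans aa am) (leq_trans mb bb).
Qed.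

Lemma measurable_csum_in (J : set I) a b : block a b `<=` J ->
  measurable_fun setT (csum a b : sig J -> R).
Proof.
move=> bJ.
have [ba|ab] := leqP b a.
  rewrite (_ : csum a b = cst 0); first exact: measurable_cst.
  by apply/funext => w; rewrite /csum big_geq.
rewrite (_ : csum a b = fun w => \sum_(i < b - a) (X (idx (a + i)) w - y)); last first.
  apply/funext => w; rewrite /csum -{1}[a]add0n big_addn big_mkord.
  by apply: eq_bigr => i _; rewrite addnC.
apply: measurable_sum => i; apply: measurable_funB => //.
apply: sigma_of_var; apply: bJ; exists (a + i)%N => //=.
by rewrite leq_addr -ltn_subRL ltn_ord.
Qed.

Lemma measurable_csum a b : measurable_fun setT (csum a b).
Proof. by apply: (@measurable_sigma_of (block a b)); exact: measurable_csum_in. Qed.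

Lemma csumD a b c w : (a <= b)%N -> (b <= c)%N -> csum a c w = csum a b w + csum b c w.
Proof. by move=> ab bc; rewrite /csum (big_cat_nat (n := b)). Qed.

Lemma csum_law1 a (A : set R) : measurable A ->
  P (csum a a.+1 @^-1` A) = normal_prob 0 lam A.
Proof.
move=> mA.
rewrite (_ : _ @^-1` A = X (idx a) @^-1` ((fun x => - y + x) @^-1` A)); last first.
  by apply/seteqP; split => w; rewrite /= /csum big_nat1 addrC.
rewrite lawX; last first.
  rewrite -[X in measurable X]setTI.
  apply: (_ : measurable_fun setT (fun x : R => - y + x)) => //.
  exact: measurable_funD.
rewrite (normal_prob_shift _ _ _ _ mA); apply: eq_integral => x _.
have lamN : lam != 0 by rewrite gt_eqF.
rewrite (@normal_pdfE _ y lam lamN) (@normal_pdfE _ 0 lam lamN) /normal_fun.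
by rewrite opprK addrK subr0.
Qed.

(** One summand is added at a time. The length is [n.+1] because an empty sum would have standard
    deviation 0. *)
Lemma csum_law a n (A : set R) : measurable A ->
  P (csum a (a + n.+1) @^-1` A) = normal_prob 0 (Num.sqrt n.+1%:R * lam) A.
Proof.
elim: n A => [|n IHn] A mA; first by rewrite addn1 sqrtr1 mul1r csum_law1.
have s0 k : 0 < Num.sqrt k.+1%:R * lam by rewrite mulr_gt0// sqrtr_gt0 ltr0n.
rewrite (_ : csum a (a + n.+2) = csum a (a + n.+1) \+ csum (a + n.+1) (a + n.+1).+1); last first.
  by apply/funext => w; rewrite -addnS [LHS](@csumD _ (a + n.+1)) ?leq_addr// ?addnS.
rewrite -[X in normal_prob X]addr0.
apply: (@normal_add_indep (block a (a + n.+1)) (block (a + n.+1) (a + n.+1).+1)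
  _ _ 0 (Num.sqrt n.+1%:R * lam) 0 lam) => //.
- exact: block_disj.
- exact: measurable_csum_in.
- exact: measurable_csum_in.
- exact: csum_law1.
rewrite !exprMn !sqr_sqrtr ?ler0n//.
by rewrite -[in LHS]natr1; ring.
Qed.

Lemma measurable_norm_ge {d'} {T : measurableType d'} (f : T -> R) (c : R) :
  measurable_fun setT f -> measurable [set w | c <= `|f w|].
Proof.
move=> mf.
rewrite (_ : [set _ | _] = setT `&` (fun w => `|f w|) @^-1` `[c, +oo[); last first.
  by apply/seteqP; split => x /=; rewrite in_itv/= andbT; [split|case].
apply: (_ : measurable_fun setT (fun w => `|f w|)) => //.
exact: measurableT_comp.
Qed.

Lemma measurable_ge {d'} {T : measurableType d'} (f : T -> R) (c : R) :
  measurable_fun setT f -> measurable [set w | c <= f w].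
Proof.
move=> mf.
rewrite (_ : [set _ | _] = setT `&` f @^-1` `[c, +oo[); last first.
  by apply/seteqP; split => x /=; rewrite in_itv/= andbT; [split|case].
exact: mf.
Qed.

Lemma csum_tail a b (c : R) : (a <= b)%N -> 0 < c ->
  (P [set w | (c <= `|csum a b w|)%R] <= (6 * (b - a)%:R * lam ^+ 2 / c ^+ 2)%:E)%E.
Proof.
move=> ab c0; have [ltab|] := ltnP a b; last first.
  move=> ba; have -> : b = a by apply/eqP; rewrite eqn_leq ab ba.
  rewrite subnn mulr0 !mul0r (_ : [set _ | _] = set0) ?measure0//.
  rewrite -subset0 => w /=; rewrite /csum big_geq// normr0 leNgt.
  by rewrite c0.
have -> : b = (a + (b - a).-1.+1)%N by rewrite prednK ?subn_gt0// subnKC.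
set n := (b - a).-1.
have mc : measurable [set x : R | c <= `|x - 0|].
  by apply: measurable_norm_ge; exact: measurable_funB.
rewrite (_ : [set w | _] = csum a (a + n.+1) @^-1` [set x | c <= `|x - 0|]); last first.
  by apply/seteqP; split => w /=; rewrite subr0.
have s0 : 0 < Num.sqrt n.+1%:R * lam by rewrite mulr_gt0// sqrtr_gt0 ltr0n.
rewrite csum_law// (le_trans (normal_prob_tail _ _ _ _ _))// lee_fin addKn.
by rewrite exprMn sqr_sqrtr ?ler0n// mulrA.
Qed.

(** One [e] serves blocks of every length; [csum_hit] needs this to multiply failure probabilities
    along growing blocks. *)
Lemma csum_upper (K : R) : 0 <= K -> exists2 e : R, 0 < e &
  forall a b, (a < b)%N ->
    (e%:E <= P [set w | (K * Num.sqrt (b - a)%:R * lam <= csum a b w)%R])%E.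
Proof.
move=> /normal_prob_upper[e e0 eP]; exists e => // a b ltab.
have ab := ltnW ltab.
have -> : b = (a + (b - a).-1.+1)%N by rewrite prednK ?subn_gt0// subnKC.
set n := (b - a).-1; rewrite addKn.
have s0 : 0 < Num.sqrt n.+1%:R * lam by rewrite mulr_gt0// sqrtr_gt0 ltr0n.
have mc : measurable [set x : R | 0 + K * (Num.sqrt n.+1%:R * lam) <= x].
  by apply: measurable_ge; exact: measurable_id.
rewrite (_ : [set w | _] = csum a (a + n.+1) @^-1` [set x | 0 + K * (Num.sqrt n.+1%:R * lam) <= x]); last first.
  by apply/seteqP; split => w /=; rewrite add0r mulrA.
by rewrite csum_law//; exact: eP.
Qed.

(* Ottaviani's maximal inequality: it only needs the independence of events. *)
Lemma csum_max N (c : R) : 0 < c ->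
  (P [set w | exists2 n, (n <= N)%N & (2 * c <= `|csum 0 n w|)%R] <=
   (12 * N%:R * lam ^+ 2 / c ^+ 2)%:E)%E.
Proof.
move=> c0; pose E n := [set w | 2 * c <= `|csum 0 n w|].
(* A bound above 1 is trivial. Otherwise each remaining sum stays below [c] with probability at
   least 1/2. *)
have [small|big] := leP (12 * N%:R * lam ^+ 2 / c ^+ 2) 1; last first.
  apply: (@le_trans _ _ 1%E); last by rewrite lee_fin ltW.
  apply: probability_le1.
  rewrite (_ : [set w | _] = \bigcup_(n in [set n | (n <= N)%N]) E n)//.
  by apply: bigcup_measurable => n _; apply: measurable_norm_ge; exact: measurable_csum.
(* [seqDU E n] says that [n] is the first index of size [2 * c]. It depends on the terms before [n],
   and [B n] below on the later ones; where both hold, the full sum has size at least [c]. *)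
have mEs n : @measurable _ (sig (block 0 n)) (seqDU E n).
  apply: measurableD.
    by apply: measurable_norm_ge; exact: measurable_csum_in.
  apply: bigsetU_measurable => k _; apply: measurable_norm_ge; apply: measurable_csum_in.
  by apply: block_sub => //; exact: ltnW.
have mE n : measurable (seqDU E n) by exact: sigma_of_measurable (mEs n).
pose B n := [set w | `|csum n N w| < c].
have mBs n : @measurable _ (sig (block n N)) (B n).
  rewrite (_ : B n = ~` [set w | c <= `|csum n N w|]).
    by apply: measurableC; apply: measurable_norm_ge; exact: measurable_csum_in.
  by apply/seteqP; split => w; rewrite /B /= ltNge => /negP.
have mB n : measurable (B n) by exact: sigma_of_measurable (mBs n).
have PB n : (n <= N)%N -> ((1 / 2)%:E <= P (B n))%E.
  move=> nN; rewrite (_ : B n = ~` [set w | c <= `|csum n N w|]); last first.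
    by apply/seteqP; split => w; rewrite /B /= ltNge => /negP.
  rewrite probability_setC; last by apply: measurable_norm_ge; exact: measurable_csum.
  have h : (P [set w | (c <= `|csum n N w|)%R] <= (1 / 2)%:E)%E.
    apply: (le_trans (csum_tail nN c0)); rewrite lee_fin.
    have : 6 * (N - n)%:R * lam ^+ 2 / c ^+ 2 <= 6 * N%:R * lam ^+ 2 / c ^+ 2.
      rewrite ler_pM2r ?invr_gt0 ?exprn_gt0// ler_pM2r ?exprn_gt0//.
      by rewrite ler_pM2l// ler_nat leq_subr.
    lra.
  have -> : ((1 / 2)%:E = 1 - (1 / 2)%:E :> \bar R)%E.
    by rewrite -EFinB; congr EFin; field.
  exact: leeB.
have half n : (n <= N)%N -> (P (seqDU E n) <= 2%:E * P (seqDU E n `&` B n))%E.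
  move=> nN; rewrite (sigma_of_indep mX indX _ (mEs n) (mBs n)); last exact: block_disj.
  have key (u v : \bar R) : u \is a fin_num -> v \is a fin_num -> (0 <= u)%E ->
      ((1 / 2)%:E <= v)%E -> (u <= 2%:E * (u * v))%E.
    move: u v => [u||] [v||]// _ _; rewrite -!EFinM !lee_fin; nra.
  by apply: key; rewrite ?fin_num_measure// ?measure_ge0//; exact: PB.
rewrite (_ : [set w | _] = \big[setU/set0]_(n < N.+1) seqDU E n); last first.
  by rewrite -bigsetU_seqDU -(bigcup_mkord _ E); apply/seteqP; split => w [n nN En]; exists n.
rewrite (measure_bigsetU P mE (@trivIset_seqDU _ E)).
apply: (@le_trans _ _ (\sum_(n < N.+1) 2%:E * P (seqDU E n `&` B n))%E).
  by apply: lee_sum => n _; apply: half; rewrite -ltnS.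
rewrite -ge0_sume_distrr//.
have mEB n : measurable (seqDU E n `&` B n) by exact: measurableI.
have tEB : trivIset setT (fun n => seqDU E n `&` B n).
  by apply: trivIset_setIr; exact: trivIset_seqDU.
rewrite -(measure_bigsetU P mEB tEB).
apply: (@le_trans _ _ (2%:E * P [set w | (c <= `|csum 0 N w|)%R])%E).
  apply: lee_wpmul2l => //; apply: le_measure; rewrite ?inE//.
  - by apply: bigsetU_measurable => n _; exact: measurableI.
  - by apply: measurable_norm_ge; exact: measurable_csum.
  rewrite -(bigcup_mkord _ (fun n : nat => seqDU E n `&` B n)) => w [n /= nN [[En _] Bn]] /=.
  move: En Bn; rewrite /E /B /= (@csumD 0 n N)//.
  by have := ler_normB (csum 0 n w + csum n N w) (csum n N w); rewrite addrK; lra.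
apply: (@le_trans _ _ (2%:E * (6 * (N - 0)%:R * lam ^+ 2 / c ^+ 2)%:E)%E).
  by apply: lee_wpmul2l => //; exact: csum_tail.
rewrite -EFinM lee_fin subn0; lra.
Qed.

End NormalSums.

(** * Almost sure behaviour of sample means *)

Section StreamLimits.
Set Implicit Arguments.
Unset Strict Implicit.
Context {d : measure_display} {Omega : measurableType d} {R : realType}.
Variables (P : probability Omega R) (I : eqType) (X : I -> Omega -> R).
Hypothesis mX : forall i, measurable_fun setT (X i).
Hypothesis indX : mutually_independent P X.

Local Notation sig := (sigma_of X).

Lemma negligible_small (B : set Omega) :
  (forall e : R, 0 < e -> exists C, [/\ measurable C, (P C <= e%:E)%E & B `<=` C]) ->
  P.-negligible B.
Proof.
move=> h.
have /choice[C CP] : forall q : nat, exists C,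
    [/\ measurable C, (P C <= (q.+1%:R^-1)%:E)%E & B `<=` C].
  by move=> q; apply: h; rewrite invr_gt0 ltr0n.
have mC : measurable (\bigcap_q C q) by apply: bigcap_measurable => // q _; case: (CP q).
exists (\bigcap_q C q); split => //; last first.
  by move=> w Bw q _; case: (CP q) => _ _; exact.
apply/eqP; rewrite eq_le measure_ge0 andbT.
have /fineK <- := fin_num_measure P _ mC.
rewrite lee_fin; apply/ler_addgt0Pr => e e0; rewrite add0r.
have [q qe] : exists q : nat, q.+1%:R^-1 < e.
  by exists (Num.truncn e^-1); rewrite invf_plt ?posrE// Num.Theory.truncnS_gt.
rewrite ltW//; apply: le_lt_trans qe; rewrite -lee_fin fineK ?fin_num_measure//.
case: (CP q) => mCq + _; apply: le_trans; apply: le_measure; rewrite ?inE//.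
exact: bigcap_inf.
Qed.

(* The first n at which H n occurs is independent of the family G. *)
Lemma first_success (J J' : set I) (H G : nat -> set Omega) (eta : R) :
  J `&` J' = set0 ->
  (forall n, @measurable _ (sig J) (H n)) ->
  (forall n, @measurable _ (sig J') (G n)) ->
  (forall n, ((1 - eta)%:E <= P (G n))%E) -> eta <= 1 ->
  P (\bigcup_n H n) = 1%E ->
  ((1 - eta)%:E <= P (\bigcup_n (H n `&` G n)))%E.
Proof.
move=> JJ0 sH sG PG eta1 PH.
have sU n : @measurable _ (sig J) (seqDU H n) by exact: seqDU_measurable.
have mU n : measurable (seqDU H n) by exact: sigma_of_measurable (sU n).
have mH n : measurable (H n) by exact: sigma_of_measurable (sH n).
have mG n : measurable (G n) by exact: sigma_of_measurable (sG n).
have tUG : trivIset setT (fun n => seqDU H n `&` G n).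
  by apply: trivIset_setIr; exact: trivIset_seqDU.
have mUG n : measurable (seqDU H n `&` G n) by exact: measurableI.
have mHG n : measurable (H n `&` G n) by exact: measurableI.
apply: (@le_trans _ _ (P (\bigcup_n (seqDU H n `&` G n)))); last first.
  apply: le_measure; rewrite ?inE; [exact: bigcup_measurable|exact: bigcup_measurable|].
  by apply: subset_bigcup => n _; apply: setSI; exact: subDsetl.
have -> : P (\bigcup_n (seqDU H n `&` G n)) = (\sum_(n <oo) P (seqDU H n `&` G n))%E.
  by apply: measure_semi_bigcup => //; exact: bigcup_measurable.
rewrite -[leLHS]mule1 -PH seqDU_bigcup_eq.
have -> : P (\bigcup_n seqDU H n) = (\sum_(n <oo) P (seqDU H n))%E.
  by apply: measure_semi_bigcup; [exact: mU|exact: trivIset_seqDU|exact: bigcup_measurable].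
rewrite -nneseriesZl//; apply: lee_nneseries => n _.
  by rewrite mule_ge0// lee_fin subr_ge0.
rewrite (sigma_of_indep mX indX JJ0 (sU n) (sG n)) muleC.
by apply: lee_wpmul2l.
Qed.

Variables (idx : nat -> I) (y lam : R).
Hypothesis idx_inj : injective idx.
Hypothesis lam0 : 0 < lam.
Hypothesis lawX : forall m (A : set R), measurable A ->
  P (X (idx m) @^-1` A) = normal_prob y lam A.

Local Notation csum := (csum X idx y).
Local Notation block := (block idx).

(* Maximal inequality on the dyadic ranges n <= 2 ^ k.+1 * m. *)
Lemma csum_sup m (c : R) : (0 < m)%N -> 0 < c ->
  (P (\bigcup_(n in [set n | (m <= n)%N]) [set w | (c * n%:R <= `|csum 0 n w|)%R]) <=
   (192 * lam ^+ 2 / (c ^+ 2 * m%:R))%:E)%E.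
Proof.
move=> m0 c0.
have mR : 0 < m%:R :> R by rewrite ltr0n.
(* [2 * c' k] is [c] times the left end of the [k]-th dyadic range. The maximal inequality then
   gives [96 / 2 ^ k = 192 / 2 ^ k.+1] times [lam ^+ 2 / (c ^+ 2 * m%:R)], and the weights
   [1 / 2 ^ k.+1] sum to 1. *)
pose c' k : R := c * (2 ^ k)%:R * m%:R / 2.
have c'0 k : 0 < c' k by rewrite /c' !mulr_gt0// ?ltr0n ?expn_gt0.
pose M k := [set w | exists2 n, (n <= 2 ^ k.+1 * m)%N & 2 * c' k <= `|csum 0 n w|].
have mM k : measurable (M k).
  rewrite (_ : M k = \bigcup_(n in [set n | (n <= 2 ^ k.+1 * m)%N]) [set w | 2 * c' k <= `|csum 0 n w|])//.
  by apply: bigcup_measurable => n _; apply: measurable_norm_ge; exact: (measurable_csum mX).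
apply: (@le_trans _ _ (\sum_(k <oo) P (M k))%E).
  apply: measure_sigma_subadditive => //.
    by apply: bigcup_measurable => n _; apply: measurable_norm_ge; exact: (measurable_csum mX).
  move=> w [n /= mn cn].
  have nm0 : (0 < n %/ m)%N by rewrite divn_gt0.
  have /andP[k1 k2] := trunc_log_bounds (isT : (1 < 2)%N) nm0.
  exists (trunc_log 2 (n %/ m)) => //; exists n.
    by apply: ltnW; rewrite -ltn_divLR.
  apply: le_trans cn; rewrite /c' mulrC divfK// -mulrA ler_pM2l//.
  by rewrite -natrM ler_nat -leq_divRL.
apply: (@le_trans _ _ (\sum_(k <oo) ((192 * lam ^+ 2 / (c ^+ 2 * m%:R)) / (2 ^ k.+1)%:R)%:E)%E); last first.
  have C0 : 0 <= 192 * lam ^+ 2 / (c ^+ 2 * m%:R).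
    by apply: divr_ge0; apply: mulr_ge0; rewrite ?ler0n ?sqr_ge0//.
  exact: (epsilon_trick0 predT C0).
apply: lee_nneseries => // k _.
apply: (le_trans (csum_max mX indX idx_inj lam0 lawX _ (c'0 k))).
rewrite lee_fin le_eqVlt; apply/orP; left; apply/eqP.
rewrite /c' natrM expnS natrM.
field.
by rewrite !gt_eqF// ltr0n expn_gt0.
Qed.

(** No summation over [n] is needed: [csum_sup] controls the whole tail from [m] on by a multiple of
    [1 / m]. *)
Lemma csum_slln : {ae P, forall w, forall q : nat,
  exists m, forall n, (m <= n)%N -> `|csum 0 n w| <= q.+1%:R^-1 * n%:R}.
Proof.
apply: ae_foralln => q; set c : R := q.+1%:R^-1.
have c0 : 0 < c by rewrite invr_gt0 ltr0n.
apply: negligible_small => e e0.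
pose m := (Num.truncn (192 * lam ^+ 2 / c ^+ 2 / e)).+1.
exists (\bigcup_(n in [set n | (m <= n)%N]) [set w | (c * n%:R <= `|csum 0 n w|)%R]); split.
- by apply: bigcup_measurable => n _; apply: measurable_norm_ge; exact: (measurable_csum mX).
- apply: (le_trans (csum_sup _ c0)) => //; rewrite lee_fin.
  have m0 : 0 < m%:R :> R by rewrite ltr0n.
  have : 192 * lam ^+ 2 / c ^+ 2 / e < m%:R by rewrite /m Num.Theory.truncnS_gt.
  rewrite ltr_pdivrMr// => h; rewrite invfM mulrA ler_pdivrMr//.
  by rewrite (mulrC e) ltW.
move=> w /= hw; apply: contrapT => hn; apply: hw; exists m => n mn.
by rewrite leNgt; apply/negP => h; apply: hn; exists n => //=; exact: ltW.
Qed.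

Lemma csum_hit (K : R) m : 0 <= K ->
  P (\bigcup_n [set w | (m <= n)%N /\ K * Num.sqrt n%:R <= csum 0 n w]) = 1%E.
Proof.
move=> K0.
(* Along these scales csum 0 (nu r) is eventually negligible with respect to
   the square root of nu r.+1, and the increments are independent. *)
pose nu r := (2 ^ (r ^ 2))%N.
have nuS r : (nu r.+1 = nu r * 2 ^ (r * 2).+1)%N.
  by rewrite /nu -expnD; congr (_ ^ _)%N; lia.
have nu2 r : (2 * nu r <= nu r.+1)%N.
  by rewrite nuS mulnC leq_mul2l expnS leq_pmulr ?orbT// expn_gt0.
have nu0 r : (0 < nu r)%N by rewrite expn_gt0.
have nult r : (nu r < nu r.+1)%N.
  by apply: leq_trans (nu2 r); rewrite mul2n -addnn -[X in (X < _)%N]addn0 ltn_add2l.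
have nu_ge r : (r <= nu r)%N.
  by apply: (@leq_trans (r ^ 2)%N); [case: r => // r; rewrite expnS leq_pmulr// expn_gt0|exact/ltnW/ltn_expl].
(* The division by [lam] cancels the standard deviation, and the factor 2 absorbs the loss from
   [nu r.+1] to the block length [nu r.+1 - nu r], at least half of it. *)
have [e e0 eP] := csum_upper mX indX idx_inj lam0 lawX (divr_ge0 (mulr_ge0 (ler0n R 2) (addr_ge0 K0 ler01)) (ltW lam0)).
pose Z r := [set w | (K + 1) * Num.sqrt (nu r.+1)%:R <= csum (nu r) (nu r.+1) w].
pose V r := [set w | Num.sqrt (nu r.+1)%:R <= `|csum 0 (nu r) w|].
pose H n := [set w | (m <= n)%N /\ K * Num.sqrt n%:R <= csum 0 n w].
have sZ r : @measurable _ (sig (block (nu r) (nu r.+1))) (Z r).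
  by apply: measurable_ge; exact: measurable_csum_in.
have mZ r : measurable (Z r) by exact: sigma_of_measurable (sZ r).
have mV r : measurable (V r) by apply: measurable_norm_ge; exact: (measurable_csum mX).
have mH n : measurable (H n).
  have [mn|nm] := leqP m n.
    rewrite (_ : H n = [set w | K * Num.sqrt n%:R <= csum 0 n w]).
      by apply: measurable_ge; exact: (measurable_csum mX).
    by apply/seteqP; split => w; [case|split].
  by rewrite (_ : H n = set0)// -subset0 => w []; rewrite leqNgt nm.
have PZ r : (e%:E <= P (Z r))%E.
  apply: (le_trans (eP _ _ (nult r))); apply: le_measure; rewrite ?inE//.
    by apply: measurable_ge; exact: (measurable_csum mX).
  move=> w /=; apply: le_trans.
  rewrite mulrAC divfK ?gt_eqF// -[leRHS]mulrA mulrCA ler_wpM2l ?addr_ge0//.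
  have -> : 2 = Num.sqrt (2 ^+ 2) :> R by rewrite sqrtr_sqr ger0_norm.
  rewrite -sqrtrM ?sqr_ge0// ler_wsqrtr//.
  rewrite natrB ?(ltnW (nult r))//.
  have : (2 * nu r)%:R <= (nu r.+1)%:R :> R by rewrite ler_nat.
  have : 0 <= (nu r.+1)%:R :> R by rewrite ler0n.
  rewrite natrM; lra.
(* First Borel-Cantelli lemma: the probabilities are of order [nu r / nu r.+1 = 2 ^ -(2 r + 1)],
   hence summable. *)
have PV0 : P (lim_sup_set V) = 0%E.
  apply: lim_sup_set_cvg0 => //.
  apply: (@le_lt_trans _ _ (12 * lam ^+ 2)%:E); last by rewrite ltry.
  apply: le_trans (epsilon_trick0 predT (_ : 0 <= 12 * lam ^+ 2)); last first.
    by rewrite mulr_ge0// sqr_ge0.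
  apply: lee_nneseries => // r _.
  have s0 : 0 < Num.sqrt (nu r.+1)%:R :> R by rewrite sqrtr_gt0 ltr0n.
  apply: (le_trans (csum_tail mX indX idx_inj lam0 lawX (leq0n _) s0)).
  rewrite lee_fin subn0 sqr_sqrtr ?ler0n// nuS natrM expnS mulnC natrM.
  have nR : 0 < (nu r)%:R :> R by rewrite ltr0n.
  have -> : 6 * (nu r)%:R * lam ^+ 2 / ((nu r)%:R * ((2 ^ (r * 2))%:R * 2%:R)) =
      6 * lam ^+ 2 / ((2 ^ (r * 2))%:R * 2) :> R.
    by field; rewrite !gt_eqF// ltr0n expn_gt0.
  have l2 : 0 <= lam ^+ 2 by rewrite sqr_ge0.
  have h : (2 ^ r)%:R <= (2 ^ (r * 2))%:R :> R by rewrite ler_nat leq_exp2l// leq_pmulr.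
  have h0 : 0 < (2 ^ r)%:R :> R by rewrite ltr0n expn_gt0.
  rewrite expnS natrM ler_pdivrMr ?mulr_gt0 ?ltr0n ?expn_gt0// mulrAC ler_pdivlMr ?mulr_gt0//.
  by nra.
(* Divergence half of Borel-Cantelli: [C n] is the failure of [n] consecutive independent
   increments, of probability at most [(1 - e) ^+ n]. Since the past costs at most one square root
   by [PV0], [K + 1] in [Z] leaves the required [K]. *)
have PZ0 r1 : P (\bigcap_(r in [set r | (r1 <= r)%N]) ~` Z r) = 0%E.
  pose C := fix C n : set Omega := if n is n'.+1 then C n' `&` ~` Z (r1 + n')%N else setT.
  have CS n : C n.+1 = C n `&` ~` Z (r1 + n)%N by [].
  have nu_mono a b : (a <= b)%N -> (nu a <= nu b)%N.
    by move=> ab; rewrite leq_exp2l// leq_exp2r.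
  have sC n : @measurable _ (sig (block 0 (nu (r1 + n)))) (C n).
    elim: n => [|n IHn]; first exact: measurableT.
    rewrite CS; apply: measurableI.
      by apply: sigma_of_sub IHn; apply: block_sub => //; apply: nu_mono; lia.
    apply: measurableC; apply: sigma_of_sub (sZ _); apply: block_sub => //.
    by apply: nu_mono; lia.
  have e1 : e <= 1.
    by rewrite -lee_fin (le_trans (PZ 0%N))// probability_le1.
  have PC n : (P (C n) <= ((1 - e) ^+ n)%:E)%E.
    elim: n => [|n IHn]; first by rewrite /= probability_setT expr0.
    rewrite CS (sigma_of_indep mX indX _ (sC n) (measurableC (sZ (r1 + n)%N))); last exact: (block_disj idx_inj).
    rewrite exprSr EFinM; apply: lee_pmul => //.
    rewrite (probability_setC P (mZ _)) EFinB; exact: leeB.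
  have mcap : measurable (\bigcap_(r in [set r | (r1 <= r)%N]) ~` Z r).
    by apply: bigcap_measurableType => r _; exact: measurableC.
  apply/eqP; rewrite eq_le measure_ge0 andbT.
  have /fineK <- := fin_num_measure P _ mcap.
  rewrite lee_fin; apply/ler_addgt0Pr => eps eps0; rewrite add0r.
  have cv : (1 - e) ^+ n @[n --> \oo] --> 0 by apply: cvg_expr; rewrite ger0_norm; lra.
  have [n _ /(_ n (leqnn n))/= hn] := cvgr_lt 0 cv eps eps0.
  apply: ltW; apply: le_lt_trans hn; rewrite -lee_fin fineK ?fin_num_measure//.
  apply: le_trans (PC n); apply: le_measure; rewrite ?inE//.
    exact: sigma_of_measurable (sC n).
  elim: n => [//|n IHn] w hw; rewrite CS; split; first exact: IHn.
  by apply: hw => /=; rewrite leq_addr.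
have mU : measurable (\bigcup_n H n) by exact: bigcup_measurable.
have : P.-negligible (~` \bigcup_n H n).
  apply: (@negligibleS _ _ _ P (lim_sup_set V `|` \bigcup_r1 \bigcap_(r in [set r | (r1 <= r)%N]) ~` Z r)).
    move=> w hw; apply: contrapT => /not_orP[nV nZ]; apply: hw.
    have [r0 hr0] : exists r0, forall r, (r0 <= r)%N -> ~ V r w.
      apply: contrapT => h; apply: nV => r0 _; apply: contrapT => h'; apply: h.
      by exists r0 => r rr Vr; apply: h'; exists r.
    have [r [rr Zr]] : exists r, (maxn r0 m <= r)%N /\ Z r w.
      apply: contrapT => h; apply: nZ; exists (maxn r0 m) => // r rr Zr.
      by apply: h; exists r.
    move: rr; rewrite geq_max => /andP[r0r mr].
    exists (nu r.+1) => //; split.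
      by apply: leq_trans (nu_ge _); exact: leqW.
    have := hr0 _ r0r; rewrite /V /= => /negP; rewrite -ltNge.
    move: Zr; rewrite /Z /= (csumD X idx y w (leq0n (nu r)) (ltnW (nult r))).
    set s := Num.sqrt _; set a := csum _ _ _; set b := csum _ _ _.
    move=> h1; rewrite ltr_norml => /andP[h2 h3]; lra.
  apply: negligibleU.
    by exists (lim_sup_set V); split => //; apply: bigcap_measurableType => n _; exact: bigcup_measurable.
  apply: negligible_bigcup => r1; exists (\bigcap_(r in [set r | (r1 <= r)%N]) ~` Z r); split => //.
    by apply: bigcap_measurableType => r _; exact: measurableC.
  exact: PZ0.
move=> negU; have : P (~` \bigcup_n H n) = 0%E.
  by apply: measure_negligible negU; exact: measurableC.
rewrite (probability_setC P mU).
have /fineK <- := fin_num_measure P _ mU.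
by rewrite -EFinB => -[] /eqP; rewrite subr_eq0 => /eqP <-.
Qed.

End StreamLimits.

Section StreamFamilies.
Set Implicit Arguments.
Unset Strict Implicit.
Context {d : measure_display} {Omega : measurableType d} {R : realType}.
Variables (P : probability Omega R) (I : eqType) (X : I -> Omega -> R).
Hypothesis mX : forall i, measurable_fun setT (X i).
Hypothesis indX : mutually_independent P X.
Variables (idx0 : nat -> I) (y0 lam0 : R).
Hypothesis idx0_inj : injective idx0.
Hypothesis lam0_gt0 : 0 < lam0.
Hypothesis lawX0 : forall m (A : set R), measurable A ->
  P (X (idx0 m) @^-1` A) = normal_prob y0 lam0 A.
Variables (T : finType) (idx : T -> nat -> I) (y lam : T -> R).
Hypothesis idx_inj : forall j, injective (idx j).
Hypothesis lam_gt0 : forall j, 0 < lam j.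
Hypothesis lawX : forall j m (A : set R), measurable A ->
  P (X (idx j m) @^-1` A) = normal_prob (y j) (lam j) A.
Hypothesis idx_disj : forall j m n, idx0 m != idx j n.

Local Notation sig := (sigma_of X).

(* Infinitely often, stream idx0 overshoots its mean by more than the largest later
   overshoot of all the other streams. This rules out that the algorithm keeps
   comparing tied solutions forever while neglecting another pair. *)
Lemma ae_dominating : {ae P, forall w, forall La q nu0 : nat,
  exists nu, (nu0 < nu)%N /\ forall j n, (nu <= q * n)%N ->
    La%:R / Num.sqrt nu%:R + csum X (idx j) (y j) 0 n w / n%:R <=
    csum X idx0 y0 0 nu w / nu%:R}.
Proof.
apply: ae_foralln => La; apply: ae_foralln => q; apply: ae_foralln => nu0.
apply: negligible_small => e e0.
pose eta := Num.min e 1.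
have eta0 : 0 < eta by rewrite lt_min e0 ltr01.
have eta1 : eta <= 1 by rewrite ge_min lexx orbT.
(* [S / L ^+ 2] will bound the probability that some other stream misbehaves, so [L] is chosen to
   make it at most [eta]. *)
pose S := \sum_(j : T) (192 * lam j ^+ 2 * q.+1%:R).
have S0j j : 0 <= 192 * lam j ^+ 2 * q.+1%:R.
  by apply: mulr_ge0 => //; apply: mulr_ge0; rewrite ?sqr_ge0 ?ler0n.
have S0 : 0 <= S by exact: sumr_ge0.
pose L := S / eta + 1.
have Se : 0 <= S / eta by rewrite divr_ge0// ltW.
have L1 : 1 <= L by rewrite lerDr.
have SL : S <= L ^+ 2 * eta.
  rewrite -ler_pdivrMr//; apply: (@le_trans _ _ L); first by rewrite lerDl.
  by rewrite expr2 ler_peMl// (le_trans ler01).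
have L0 : 0 < L by exact: lt_le_trans L1.
pose H n := [set w | (nu0.+1 <= n)%N /\ (La%:R + L) * Num.sqrt n%:R <= csum X idx0 y0 0 n w].
(* Using [q.+1] avoids a division by 0. The target stream must overshoot by [La + L] square roots
   because the others may use up [L] of them. *)
pose Bad j n := \bigcup_(k in [set k | (0 < n)%N /\ (n <= q.+1 * k)%N])
  [set w | L / Num.sqrt n%:R * k%:R <= `|csum X (idx j) (y j) 0 k w|].
pose G n := ~` \big[setU/set0]_(j : T) Bad j n.
pose J := [set idx0 m | m in [set: nat]].
pose J' := [set i | exists j m, idx j m = i].
have JJ0 : J `&` J' = set0.
  rewrite -subset0 => i [[m _ <-] [j [n /esym /eqP]]].
  by apply/negP; exact: idx_disj.
have sH n : @measurable _ (sig J) (H n).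
  have [mn|nm] := ltnP nu0 n; last first.
    by rewrite (_ : H n = set0)// -subset0 => w []; rewrite ltnNge nm.
  rewrite (_ : H n = [set w | (La%:R + L) * Num.sqrt n%:R <= csum X idx0 y0 0 n w]).
    apply: measurable_ge; apply: measurable_csum_in => _ [m _ <-].
    by exists m.
  by apply/seteqP; split => w; [case|split].
have sB j n : @measurable _ (sig J') (Bad j n).
  apply: bigcup_measurable => k _; apply: measurable_norm_ge.
  by apply: measurable_csum_in => _ [m _ <-]; exists j, m.
have sG n : @measurable _ (sig J') (G n).
  by apply: measurableC; apply: bigsetU_measurable.
have mB j n : measurable (Bad j n) by exact: (sigma_of_measurable mX (sB j n)).
have mG n : measurable (G n) by exact: (sigma_of_measurable mX (sG n)).
have mH n : measurable (H n) by exact: (sigma_of_measurable mX (sH n)).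
have PB j n : (P (Bad j n) <= ((192 * lam j ^+ 2 * q.+1%:R) / L ^+ 2)%:E)%E.
  have [->|n0] := posnP n.
    rewrite (_ : Bad j 0 = set0); last by rewrite -subset0 => w [k []].
    by rewrite measure0 lee_fin divr_ge0 ?sqr_ge0.
  have nR : 0 < n%:R :> R by rewrite ltr0n.
  have c0 : 0 < L / Num.sqrt n%:R by rewrite divr_gt0// sqrtr_gt0.
  (* The ceiling of [n / q.+1], the least count that [Bad] allows. *)
  pose m := (n.-1 %/ q.+1).+1.
  apply: (@le_trans _ _ (P (\bigcup_(k in [set k | (m <= k)%N])
     [set w | (L / Num.sqrt n%:R * k%:R <= `|csum X (idx j) (y j) 0 k w|)%R]))).
    apply: le_measure; rewrite ?inE//.
      by apply: bigcup_measurable => k _; apply: measurable_norm_ge; exact: (measurable_csum mX).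
    apply: bigcup_subset => k /= [_ nk].
    by rewrite /m ltn_divLR// mulnC; apply: leq_trans nk; rewrite prednK.
  apply: (le_trans (csum_sup mX indX (@idx_inj j) (lam_gt0 j) (@lawX j) (ltn0Sn _) c0)).
  rewrite lee_fin expr_div_n sqr_sqrtr ?ler0n//.
  have nm : (n <= m * q.+1)%N.
    have := ltn_ceil n.-1 (ltn0Sn q); rewrite -/m => h.
    by rewrite -[n]prednK.
  have nmR : n%:R <= m%:R * q.+1%:R :> R by rewrite -natrM ler_nat.
  have mR : 0 < m%:R :> R by rewrite ltr0n.
  rewrite (_ : 192 * lam j ^+ 2 / (L ^+ 2 / n%:R * m%:R) = 192 * lam j ^+ 2 * (n%:R / m%:R) / L ^+ 2); last first.
    by field; rewrite !gt_eqF.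
  rewrite ler_pM2r ?invr_gt0 ?exprn_gt0//; apply: ler_wpM2l.
    by rewrite mulr_ge0 ?ler0n ?sqr_ge0.
  by rewrite ler_pdivrMr// mulrC.
have PG n : ((1 - eta)%:E <= P (G n))%E.
  have mU : measurable (\big[setU/set0]_(j : T) Bad j n) by exact: bigsetU_measurable.
  rewrite /G (probability_setC P mU) EFinB; apply: leeB => //.
  apply: (@le_trans _ _ (\sum_(j : T) ((192 * lam j ^+ 2 * q.+1%:R) / L ^+ 2)%:E)%E).
    suff [] : measurable (\big[setU/set0]_(j : T) Bad j n) /\
      (P (\big[setU/set0]_(j : T) Bad j n) <= \sum_(j : T) ((192 * lam j ^+ 2 * q.+1%:R) / L ^+ 2)%:E)%E by [].
    elim/big_rec2: _ => [|j s U _ [mU' PU]]; first by rewrite measure0.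
    split; first exact: measurableU.
    apply: (le_trans (measureU2 _ _ _)) => //.
    exact: leeD (PB j n) PU.
  rewrite sumEFin lee_fin -mulr_suml -/S ler_pdivrMr ?exprn_gt0//.
  by rewrite mulrC.
have PH : P (\bigcup_n H n) = 1%E.
  apply: (csum_hit mX indX idx0_inj lam0_gt0 lawX0).
  by rewrite addr_ge0 ?ler0n// ltW.
have mHG : measurable (\bigcup_n (H n `&` G n)).
  by apply: bigcup_measurable => n _; exact: measurableI.
exists (~` \bigcup_n (H n `&` G n)); split; first exact: measurableC.
  rewrite (probability_setC P mHG).
  have := first_success mX indX JJ0 sH sG PG eta1 PH.
  have /fineK <- := fin_num_measure P _ mHG.
  rewrite -EFinB !lee_fin => h.
  have : eta <= e by rewrite ge_min lexx.
  by move: h; lra.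
apply: subsetC => w [n _ [[n0 Hn] Gn]]; exists n; split => // j k nk.
have nR : 0 < n%:R :> R by rewrite ltr0n (leq_ltn_trans _ n0).
have k0 : (0 < k)%N by case: k nk => //; rewrite muln0 leqNgt (leq_ltn_trans _ n0).
have kR : 0 < k%:R :> R by rewrite ltr0n.
have s0 : 0 < Num.sqrt n%:R :> R by rewrite sqrtr_gt0.
have : csum X (idx j) (y j) 0 k w / k%:R <= L / Num.sqrt n%:R.
  rewrite ler_pdivrMr//; apply: (le_trans (ler_norm _)); rewrite leNgt; apply/negP => /ltW h.
  apply: Gn; rewrite (bigD1 j)//=; left; exists k => //=; split.
    by rewrite (leq_ltn_trans _ n0).
  by apply: leq_trans nk _; rewrite leq_mul2r leqnSn orbT.
have : (La%:R + L) / Num.sqrt n%:R <= csum X idx0 y0 0 n w / n%:R.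
  rewrite ler_pdivlMr//; apply: le_trans Hn.
  by rewrite -{2}[n%:R]sqr_sqrtr ?ler0n// expr2 mulrA divfK// gt_eqF.
rewrite mulrDl; lra.
Qed.

End StreamFamilies.

(** * The sampling algorithm *)

Section AlgorithmStep.
Set Implicit Arguments.
Unset Strict Implicit.
Context {R : realType} {k B : nat}.
Variables (p : 'I_B -> R) (lam : 'I_k -> 'I_B -> R).
Hypothesis p_gt0 : forall b, 0 < p b.
Hypothesis p_sum : \sum_(b < B) p b = 1.
Hypothesis lam_gt0 : forall i b, 0 < lam i b.
Implicit Types (i j : 'I_k) (b c : 'I_B) (acc : bool).

(** Thus [istar] influences the selection only through the weights. *)
Lemma inDomE (ib : 'I_B -> 'I_k) istar i b : inDom ib istar i b = (i != ib b).
Proof.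
rewrite /inDom /inXi /inXiadv eq_sym; have [->|] := eqVneq istar i => /=; last by rewrite orbF.
by rewrite eq_sym.
Qed.

Lemma mass_ge0 (ib : 'I_B -> 'I_k) j : 0 <= mass p ib j.
Proof. by apply: sumr_ge0 => b _; case: ifP => // _; exact: ltW. Qed.

Lemma mass_le1 (ib : 'I_B -> 'I_k) j : mass p ib j <= 1.
Proof. by rewrite -p_sum; apply: ler_sum => b _; case: ifP => // _; exact: ltW. Qed.

Lemma dgap_le1 (ib : 'I_B -> 'I_k) istar j : dgap p ib istar j <= 1.
Proof. by rewrite /dgap; have := mass_le1 ib istar; have := mass_ge0 ib j; lra. Qed.

Lemma Wxi_ge1 (ib : 'I_B -> 'I_k) istar i b : 1 <= Wxi p ib istar i b.
Proof. by rewrite /Wxi; case: ifP => _; rewrite le_max lexx orbT. Qed.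

Lemma Wrule_ge1 (ib : 'I_B -> 'I_k) istar acc i b : 1 <= Wrule p ib istar acc i b.
Proof.
by rewrite /Wrule /W_ACC /W_FN; case: acc; case: ifP => // _; exact: Wxi_ge1.
Qed.

Lemma Wxi_le (ib : 'I_B -> 'I_k) istar i b :
  Wxi p ib istar i b <= Num.max (p b)^-1 1.
Proof.
have pb := p_gt0 b; have d1 := dgap_le1 ib istar i.
rewrite /Wxi; case: ifP => _; rewrite ge_max !le_max lexx orbT andbT; apply/orP; left.
  rewrite -[leRHS]mul1r ler_pM2r ?invr_gt0// ge_min; apply/orP; right.
  by rewrite ler_pdivrMr//; lra.
by rewrite -[leRHS]mul1r ler_pM2r ?invr_gt0.
Qed.

(** Masses lie in [[0, 1]], so the plug-in weights are bounded uniformly even while the estimated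
    bests are wrong. *)
Lemma Wrule_le (ib : 'I_B -> 'I_k) istar acc i b :
  Wrule p ib istar acc i b <= Num.max (p b)^-1 1.
Proof.
rewrite /Wrule /W_ACC /W_FN; case: acc; case: ifP => _;
  by rewrite ?Wxi_le// le_max lexx orbT.
Qed.

Variable obs : 'I_k -> 'I_B -> nat -> R.
Implicit Type N : 'I_k -> 'I_B -> nat.

Lemma ebestdP N x0 b j : mean obs N (ebestd obs N x0 b) b <= mean obs N j b.
Proof.
rewrite /ebestd /ebest; case: pickP => [i /forallP//|noi] /=.
case: (@arg_minP _ _ _ x0 xpredT (fun i => mean obs N i b) isT) => i _ ih.
by have /negP[] := noi i; apply/forallP => j'; exact: ih.
Qed.

(** A minimiser over a nonempty finite type exists, so the default never shows. The definitions pass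
    whichever index is at hand; this replaces it by one fixed [x0]. *)
Lemma ebestd_default N x0 x1 : ebestd obs N x0 = ebestd obs N x1.
Proof.
apply/funext => b; rewrite /ebestd /ebest; case: pickP => [//|noi] /=.
case: (@arg_minP _ _ _ x0 xpredT (fun i => mean obs N i b) isT) => i _ ih.
by have /negP[] := noi i; apply/forallP => j'; exact: ih.
Qed.

Lemma estar_some N x0 : exists2 i, estar p lam obs N x0 = Some i &
  forall j, mass p (ebestd obs N x0) j <= mass p (ebestd obs N x0) i.
Proof.
rewrite /estar; case: pickP => [i /andP[/forallP ih _]|noi]; first by exists i.
case: (@arg_maxP _ _ _ x0 xpredT (mass p (ebestd obs N x0)) isT) => i _ ih.
have mi : emaxer p obs N x0 i by apply/forallP => j'; exact: ih.
case: (@arg_maxP _ _ _ i (emaxer p obs N x0) (escore lam obs N x0) mi) => i' mi' ih'.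
have /negP[] := noi i'; apply/andP; split => //.
by apply/forallP => j'; apply/implyP; exact: ih'.
Qed.

Lemma estardP N x0 j :
  mass p (ebestd obs N x0) j <= mass p (ebestd obs N x0) (estard p lam obs N x0).
Proof. by rewrite /estard; have [i -> ih] := estar_some N x0. Qed.

Lemma estard_default N x0 x1 : estard p lam obs N x0 = estard p lam obs N x1.
Proof.
have e : ebestd obs N x0 = ebestd obs N x1 by exact: ebestd_default.
have eq1 : estar p lam obs N x0 = estar p lam obs N x1.
  by rewrite /estar; apply: eq_pick => j; rewrite /emaxer /escore /Gx e.
by rewrite /estard eq1; have [i -> _] := estar_some N x1.
Qed.

(** The sample rate times the total number of replications: counts take the place of the proportions
    [alpha], and the minimising pair is unchanged. *)
Definition rate N x0 i b : R :=
  (mean obs N i b - mean obs N (ebestd obs N x0 b) b) ^+ 2 /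
  (2 * (lam i b ^+ 2 / (N i b)%:R +
        lam (ebestd obs N x0 b) b ^+ 2 / (N (ebestd obs N x0 b) b)%:R)).

Lemma total_gt0 N (i : 'I_k) (b : 'I_B) : (0 < N i b)%N -> (0 < Defs.total N)%N.
Proof.
by move=> N0; rewrite /Defs.total (bigD1 i)//= (bigD1 b)//= -addnA addn_gt0 N0.
Qed.

Lemma GE N x0 i b : (forall j c, 0 < N j c)%N ->
  G lam obs N i b = rate N x0 i b / (Defs.total N)%:R.
Proof.
move=> N0; rewrite /G /Gx /rate (ebestd_default N i x0) /alpha.
have t0 : (Defs.total N)%:R != 0 :> R by rewrite pnatr_eq0 -lt0n (total_gt0 (N0 i b)).
set j := ebestd _ _ _ _.
have ni : (N i b)%:R != 0 :> R by rewrite pnatr_eq0 -lt0n.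
have nj : (N j b)%:R != 0 :> R by rewrite pnatr_eq0 -lt0n.
have e (x m : R) : x / (m / (Defs.total N)%:R) = x / m * (Defs.total N)%:R.
  by rewrite invf_div mulrA mulrAC.
by rewrite !e -mulrDl (mulrA 2) invfM mulrA.
Qed.

(** Since [k > 1] and a context [b0] is given, some pair is not a current best, so [esel] is never
    [None] and every step allocates a replication. *)
Lemma stepP N x0 acc (b0 : 'I_B) : (1 < k)%N -> (forall j c, 0 < N j c)%N ->
  let bst := ebestd obs N x0 in
  let W := Wrule p bst (estard p lam obs N x0) acc in
  exists i b, [/\ i != bst b,
    forall j c, j != bst c -> W i b * rate N x0 i b <= W j c * rate N x0 j c &
    step p lam obs N acc =
      if ((N (bst b) b)%:R / lam (bst b) b) ^+ 2 <
         \sum_(j | j != bst b) ((N j b)%:R / lam j b) ^+ 2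
      then incr N (bst b) b else incr N i b].
Proof.
move=> k1 N0 bst W.
have eWE i b : eW p lam obs N acc i b = W i b.
  by rewrite /eW (ebestd_default N i x0) (estard_default N i x0).
have eDomE i b : eDom p lam obs N i b = (i != bst b).
  by rewrite /eDom inDomE (ebestd_default N i x0).
have t0 : 0 < (Defs.total N)%:R :> R by rewrite ltr0n (total_gt0 (N0 x0 b0)).
have leE i b j c : (eW p lam obs N acc i b * G lam obs N i b <= eW p lam obs N acc j c * G lam obs N j c)
    = (W i b * rate N x0 i b <= W j c * rate N x0 j c).
  by rewrite !eWE !(GE x0)// !mulrA ler_pM2r ?invr_gt0.
rewrite /step /esel; case: pickP => [[i b] /= /andP[ib /forallP imin]|noi].
  exists i, b; split; first by rewrite -eDomE.
    by move=> j c jc; have /= := imin (j, c); rewrite eDomE jc leE.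
  by rewrite (ebestd_default N i x0).
have [i0 i0b] : exists i0, i0 != bst b0.
  have : (0 < #|predC1 (bst b0)|)%N by rewrite cardC1 card_ord -subn1 subn_gt0.
  by case/card_gt0P => i0; exists i0.
have [//|[i b] /= ib imin] := @arg_minP _ _ _ (i0, b0) (fun x : 'I_k * 'I_B => x.1 != bst x.2)
  (fun x => W x.1 x.2 * rate N x0 x.1 x.2).
have /negP[] := noi (i, b); rewrite /= eDomE ib; apply/forallP => -[j c] /=.
by rewrite eDomE leE; apply/implyP => jc; exact: (imin (j, c)).
Qed.

End AlgorithmStep.

(** * Every pair is sampled infinitely often *)

Section AllPairsSampled.
Set Implicit Arguments.
Unset Strict Implicit.
Context {R : realType} {k B : nat}.
Variables (p : 'I_B -> R) (y lam : 'I_k -> 'I_B -> R) (n0 : nat) (acc : bool).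
Hypothesis k_gt1 : (1 < k)%N.
Hypothesis n0_gt0 : (0 < n0)%N.
Hypothesis p_gt0 : forall b, 0 < p b.
Hypothesis p_sum : \sum_(b < B) p b = 1.
Hypothesis lam_gt0 : forall i b, 0 < lam i b.
Variables (obs : 'I_k -> 'I_B -> nat -> R) (x0 : 'I_k).
Implicit Types (i j : 'I_k) (b c : 'I_B).

Local Notation N := (run p lam acc n0 obs).
Local Notation bst t := (ebestd obs (N t) x0).
Local Notation W t := (Wrule p (bst t) (estard p lam obs (N t) x0) acc).
Local Notation H t := (rate lam obs (N t) x0).

Definition smean i b n : R := (\sum_(m < n) obs i b m) / n%:R.

Lemma run_ge t i b : (n0 <= N t i b)%N.
Proof.
elim: t => [//|t IHt] /=; rewrite /step; case: esel => [[j c]|//].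
by case: ifP => _; rewrite /incr; apply: leq_trans IHt (leq_addr _ _).
Qed.

Lemma run_gt0 t i b : (0 < N t i b)%N.
Proof. exact: leq_trans n0_gt0 (run_ge t i b). Qed.

Lemma run_gt0R t i b : 0 < (N t i b)%:R :> R.
Proof. by rewrite ltr0n run_gt0. Qed.

Lemma card_B_gt0 : (0 < B)%N.
Proof.
case: (B) p p_sum => // q /eqP; rewrite big_ord0 eq_sym oner_eq0.
by [].
Qed.

Lemma runP t : exists i b, [/\ i != bst t b,
    forall j c, j != bst t c -> W t i b * H t i b <= W t j c * H t j c &
    N t.+1 =
      if ((N t (bst t b) b)%:R / lam (bst t b) b) ^+ 2 <
         \sum_(j | j != bst t b) ((N t j b)%:R / lam j b) ^+ 2
      then incr (N t) (bst t b) b else incr (N t) i b].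
Proof. exact: (stepP p lam obs x0 acc (Ordinal card_B_gt0) k_gt1 (run_gt0 t)). Qed.

Lemma run_leS t i b : (N t i b <= N t.+1 i b)%N.
Proof.
by have [j [c [_ _ ->]]] := runP t; case: ifP => _; rewrite /incr leq_addr.
Qed.

Lemma run_le_incr t i b : (N t.+1 i b <= (N t i b).+1)%N.
Proof.
by have [j [c [_ _ ->]]] := runP t; case: ifP => _;
   rewrite /incr -addn1 leq_add2l leq_b1.
Qed.

Lemma total_run t : (t <= Defs.total (N t))%N.
Proof.
elim: t => [//|t IHt]; have [j [c [_ _ ->]]] := runP t.
have tincr i' b' : Defs.total (incr (N t) i' b') = (Defs.total (N t)).+1.
  rewrite /Defs.total /incr (bigD1 i')//= [in RHS](bigD1 i')//=.
  rewrite (bigD1 b')//= [in RHS](bigD1 b')//= !eqxx addn1 !addSn.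
  congr (_ + _ + _).+1.
    by apply: eq_bigr => b /negPf ->; rewrite andbF addn0.
  by apply: eq_bigr => i /negPf ->; apply: eq_bigr => b _; rewrite addn0.
by case: ifP => _; rewrite tincr.
Qed.

(** Counts rise by at most one and skip no value, so a pair sampled without bound is sampled exactly
    at the count that [dominating] prescribes. *)
Lemma run_passes i b n : (n0 <= n)%N -> (exists t, (n < N t i b)%N) ->
  exists t, N t i b = n /\ N t.+1 i b = n.+1.
Proof.
move=> n0n [t]; elim: t => [/=|t IHt]; first by rewrite ltnNge n0n.
move=> nS; have [/IHt//|Nn] := ltnP n (N t i b).
have := run_le_incr t i b; have := run_leS t i b => h1 h2.
by exists t; lia.
Qed.

Lemma run_sampled t i b : N t.+1 i b = (N t i b).+1 ->
  (exists2 j, j = bst t b & i = j /\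
     ((N t j b)%:R / lam j b) ^+ 2 <
       \sum_(j' | j' != j) ((N t j' b)%:R / lam j' b) ^+ 2) \/
  [/\ i != bst t b,
    forall j c, j != bst t c -> W t i b * H t i b <= W t j c * H t j c &
    \sum_(j | j != bst t b) ((N t j b)%:R / lam j b) ^+ 2 <=
      ((N t (bst t b) b)%:R / lam (bst t b) b) ^+ 2].
Proof.
have [i' [b' [ib imin ->]]] := runP t.
have incrP u v : incr (N t) u v i b = (N t i b).+1 -> i = u /\ b = v.
  rewrite /incr; case: andP => [[/eqP -> /eqP ->]//|_].
  by rewrite addn0 => /eqP; rewrite eqn_leq ltnn andbF.
case: ifPn => [cnd|] /=.
  by move=> /incrP[-> ->]; left; exists (bst t b').
by rewrite -leNgt => cnd /incrP[-> ->]; right.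
Qed.

Hypothesis slln : forall i b (e : R), 0 < e ->
  exists m, forall n, (m <= n)%N -> `|smean i b n - y i b| <= e.

Lemma smean_bounded : exists2 D : R, 0 < D & forall i b n, `|smean i b n| <= D.
Proof.
have bnd i b : exists D : R, forall n, `|smean i b n| <= D.
  have [m hm] := slln i b ltr01.
  have S0 : 0 <= \sum_(n < m) `|smean i b n| by apply: sumr_ge0.
  exists (`|y i b| + 1 + \sum_(n < m) `|smean i b n|) => n.
  have [mn|nm] := leqP m n.
    have := ler_normD (smean i b n - y i b) (y i b); rewrite subrK.
    by have := hm n mn; lra.
  rewrite (bigD1 (Ordinal nm))//= -[leLHS]add0r lerD ?addr_ge0// lerDl.
  by apply: sumr_ge0.
have /choice[D hD] : forall x : 'I_k * 'I_B, exists D : R, forall n, `|smean x.1 x.2 n| <= D.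
  by case=> i b; exact: bnd.
have D0 x : 0 <= D x by exact: le_trans (normr_ge0 _) (hD x 0%N).
exists (1 + \sum_x D x); first by rewrite ltr_pwDl// sumr_ge0.
move=> i b n; apply: (le_trans (hD (i, b) n)).
rewrite (bigD1 (i, b))//= addrCA lerDl addr_ge0// sumr_ge0//.
Qed.

Lemma mean_run t i b : mean obs (N t) i b = smean i b (N t i b).
Proof. by []. Qed.

Lemma rate_ge0 t i b : 0 <= H t i b.
Proof.
rewrite /rate divr_ge0 ?sqr_ge0// mulr_ge0// addr_ge0// divr_ge0 ?sqr_ge0//.
Qed.

(* When (i, b) is the current best at b, any other solution at b witnesses the bound. *)
Lemma min_rate_bounded i b m : (forall t, N t i b <= m)%N ->
  exists C : R, forall t j c, j != bst t c ->
    (forall j' c', j' != bst t c' -> W t j c * H t j c <= W t j' c' * H t j' c') ->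
    H t j c <= C.
Proof.
move=> bnd; have [D D0 hD] := smean_bounded.
pose w := Num.max (p b)^-1 1.
have w1 : 1 <= w by rewrite le_max lexx orbT.
have l0 := lam_gt0 i b.
exists (w * ((2 * D) ^+ 2 * m%:R / (2 * lam i b ^+ 2))) => t j c jb jmin.
have Hj : H t j c <= W t j c * H t j c.
  by rewrite ler_peMl ?rate_ge0// Wrule_ge1.
(* A comparison involving [i] keeps a variance of at least [lam i b ^+ 2 / m%:R], and the gap of two
   sample means is at most [2 * D]. *)
have key u v (a : R) : 0 <= a -> u = i \/ v = i ->
    (smean u b (N t u b) - smean v b (N t v b)) ^+ 2 /
    (2 * (lam u b ^+ 2 / (N t u b)%:R + lam v b ^+ 2 / (N t v b)%:R)) <=
    (2 * D) ^+ 2 * m%:R / (2 * lam i b ^+ 2).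
  move=> a0 uv; set uu := lam u b ^+ 2 / _; set vv := lam v b ^+ 2 / _.
  have uu0 : 0 < uu by rewrite divr_gt0 ?exprn_gt0 ?run_gt0R.
  have vv0 : 0 < vv by rewrite divr_gt0 ?exprn_gt0 ?run_gt0R.
  have m0 : 0 < m%:R :> R by rewrite ltr0n (leq_trans (run_gt0 0 i b)).
  have ge : lam i b ^+ 2 / m%:R <= uu + vv.
    have im : lam i b ^+ 2 / m%:R <= lam i b ^+ 2 / (N t i b)%:R.
      by rewrite ler_pM2l ?exprn_gt0// lef_pV2 ?posrE ?run_gt0R// ler_nat.
    case: uv => e; apply: (le_trans im).
      by rewrite [in leRHS]/uu e lerDl ltW.
    by rewrite [in leRHS]/vv e lerDr ltW.
  have -> : (2 * D) ^+ 2 * m%:R / (2 * lam i b ^+ 2) = (2 * D) ^+ 2 / (2 * (lam i b ^+ 2 / m%:R)).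
    by field; rewrite !gt_eqF.
  apply: ler_pM; rewrite ?sqr_ge0// ?invr_ge0; first by rewrite mulr_ge0// addr_ge0// ltW.
    rewrite -[leLHS]real_normK ?num_real// lerXn2r ?nnegrE ?mulr_ge0 ?(ltW D0)//.
    have := ler_normB (smean u b (N t u b)) (smean v b (N t v b)).
    by have := hD u b (N t u b); have := hD v b (N t v b); lra.
  have g0 : 0 < lam i b ^+ 2 / m%:R by rewrite divr_gt0 ?exprn_gt0.
  have g1 : 0 < 2 * (lam i b ^+ 2 / m%:R) by rewrite mulr_gt0.
  have g2 : 0 < 2 * (uu + vv) by rewrite mulr_gt0// addr_gt0.
  by rewrite lef_pV2 ?posrE// ler_pM2l.
have fin i' : i' != bst t b -> i' = i \/ bst t b = i -> H t j c <= w * ((2 * D) ^+ 2 * m%:R / (2 * lam i b ^+ 2)).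
  move=> ib' ii; apply: (le_trans Hj); apply: (le_trans (jmin _ _ ib')).
  apply: ler_pM; rewrite ?rate_ge0//.
  - exact: le_trans ler01 (Wrule_ge1 _ _ _ _ _ _).
  - exact: Wrule_le.
  - exact: key ler01 ii.
have [ib|/negPn/eqP ib] := boolP (i != bst t b); first by apply: (fin i) => //; left.
have : (0 < #|predC1 (bst t b)|)%N by rewrite cardC1 card_ord -subn1 subn_gt0.
by case/card_gt0P => i' i'b; apply: (fin i') => //; right.
Qed.

Lemma nat_above (T : finType) (f : T -> R) : (forall x, 0 <= f x) ->
  exists q : nat, forall x, f x <= q.+1%:R.
Proof.
move=> f0; exists (Num.truncn (\sum_x f x)) => x; apply: ltW.
apply: le_lt_trans (truncnS_gt _); rewrite (bigD1 x)//= lerDl.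
by apply: sumr_ge0.
Qed.

(* If (i, b) is sampled as the current best, the balance test fails because of
   some j with a comparable count; otherwise the current best j has passed the
   balance test, so its count is comparable, and the rate of (i, b) is bounded. *)
Lemma sampled_dominated (C : R) : (forall t j c, j != bst t c ->
    (forall j' c', j' != bst t c' -> W t j c * H t j c <= W t j' c' * H t j' c') ->
    H t j c <= C) ->
  exists q La : nat, forall t i b, N t.+1 i b = (N t i b).+1 ->
    exists j, [/\ j != i, (N t i b <= q * N t j b)%N &
      smean i b (N t i b) <= smean j b (N t j b) + La%:R / Num.sqrt (N t i b)%:R].
Proof.
move=> HC.
(* When the balance test favours the best, one of the others has at least [1 / k] of its square.
   Using [k] in place of its square root keeps the bound simple. *)
have [q hq] : exists q : nat, forall x : 'I_k * 'I_k * 'I_B,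
    k%:R * (lam x.1.1 x.2 / lam x.1.2 x.2) <= q.+1%:R.
  by apply: nat_above => x; rewrite mulr_ge0 ?ler0n// divr_ge0// ltW.
(* This bounds the squared gap times the count. An integer that is at least 1 is at most its square,
   so [La.+1] also serves as the constant for the gap itself. *)
have [La hLa] : exists q : nat, forall x : 'I_k * 'I_k * 'I_B,
    2 * `|C| * (lam x.1.1 x.2 ^+ 2 + lam x.1.1 x.2 * lam x.1.2 x.2) <= q.+1%:R.
  apply: nat_above => x; rewrite mulr_ge0 ?mulr_ge0// addr_ge0 ?sqr_ge0// mulr_ge0// ltW//.
have k1 : 1 <= k%:R :> R by rewrite ler1n ltnW.
exists q.+1, La.+1 => t i b /run_sampled[[_ -> [iE small]]|[ib imin large]].
  have [j ji jlarge] : exists2 j, j != i &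
      ((N t i b)%:R / lam i b) ^+ 2 <= k%:R * ((N t j b)%:R / lam j b) ^+ 2.
    apply: contrapT => no; move: small; rewrite -iE; apply/negP; rewrite -leNgt.
    have kR : 0 < k%:R :> R by exact: lt_le_trans k1.
    apply: (@le_trans _ _ (\sum_(j | j != i) ((N t i b)%:R / lam i b) ^+ 2 / k%:R)).
      apply: ler_sum => j ji; rewrite ler_pdivlMr// mulrC leNgt; apply/negP => h.
      by apply: no; exists j => //; exact: ltW.
    rewrite sumr_const cardC1 card_ord -[leLHS]mulr_natr mulrAC ler_pdivrMr//.
    by rewrite ler_wpM2l ?sqr_ge0// ler_nat leq_pred.
  exists j; split => //; last first.
    have := ebestdP obs (N t) x0 b j; rewrite -iE !mean_run => h.
    by rewrite (le_trans h)// lerDl divr_ge0// ler0n.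
  rewrite -(ler_nat R) natrM.
  have := hq (i, j, b); rewrite /= => h.
  apply: (@le_trans _ _ (k%:R * (lam i b / lam j b) * (N t j b)%:R)); last by rewrite ler_pM2r ?run_gt0R.
  have -> : k%:R * (lam i b / lam j b) * (N t j b)%:R =
      lam i b * (k%:R * ((N t j b)%:R / lam j b)) by field; rewrite gt_eqF.
  rewrite -ler_pdivrMl// mulrC.
  have h0 : 0 <= k%:R * ((N t j b)%:R / lam j b).
    by rewrite mulr_ge0 ?ler0n// divr_ge0 ?ler0n// ltW.
  rewrite -ler_sqr ?nnegrE ?divr_ge0 ?ler0n ?(ltW (lam_gt0 _ _))//.
  apply: (le_trans jlarge); rewrite [leRHS]exprMn ler_wpM2r ?sqr_ge0// expr2.
  by rewrite ler_peMl ?ler0n.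
set j := bst t b in ib imin large *.
have ji : j != i by rewrite eq_sym.
have ratio : (N t i b)%:R / lam i b <= (N t j b)%:R / lam j b.
  rewrite -ler_sqr ?nnegrE ?divr_ge0 ?ler0n ?(ltW (lam_gt0 _ _))//.
  apply: le_trans large; rewrite (bigD1 i)//= lerDl.
  by apply: sumr_ge0 => j' _; rewrite sqr_ge0.
exists j; split => //.
  rewrite -(ler_nat R) natrM.
  apply: (@le_trans _ _ (k%:R * (lam i b / lam j b) * (N t j b)%:R)); last first.
    by rewrite ler_pM2r ?run_gt0R//; exact: (hq (i, j, b)).
  apply: (@le_trans _ _ (lam i b * ((N t j b)%:R / lam j b))).
    by rewrite -ler_pdivrMl// mulrC.
  have -> : k%:R * (lam i b / lam j b) * (N t j b)%:R =
      k%:R * (lam i b * ((N t j b)%:R / lam j b)) by field; rewrite gt_eqF.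
  by rewrite ler_peMl// mulr_ge0 ?divr_ge0 ?ler0n ?(ltW (lam_gt0 _ _)).
have := HC t i b ib imin; rewrite /rate -/j !mean_run.
set n := (N t i b)%:R; set m := (N t j b)%:R; set D := smean i b _ - _ => HD.
have n_gt0 : 0 < n by exact: run_gt0R.
have m_gt0 : 0 < m by exact: run_gt0R.
have li := lam_gt0 i b; have lj := lam_gt0 j b.
have u0 : 0 < lam i b ^+ 2 / n + lam j b ^+ 2 / m.
  by rewrite addr_gt0// divr_gt0// exprn_gt0.
have jm : lam j b ^+ 2 / m <= lam i b * lam j b / n.
  rewrite ler_pdivrMr// mulrAC ler_pdivlMr//.
  have : n / lam i b * (lam i b * lam j b) <= m / lam j b * (lam i b * lam j b).
    by rewrite ler_pM2r ?mulr_gt0.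
  have -> : n / lam i b * (lam i b * lam j b) = lam j b * n by field; rewrite gt_eqF.
  have -> : m / lam j b * (lam i b * lam j b) = lam i b * m by field; rewrite gt_eqF.
  by nra.
have D2 : D ^+ 2 <= (La.+1%:R / Num.sqrt n) ^+ 2.
  rewrite expr_div_n sqr_sqrtr ?(ltW n_gt0)//.
  move: HD; rewrite ler_pdivrMr ?mulr_gt0// => HD; apply: (le_trans HD).
  apply: (@le_trans _ _ (2 * `|C| * (lam i b ^+ 2 / n + lam j b ^+ 2 / m))).
    by rewrite mulrCA mulrA ler_pM2r// ler_pM2l// ler_norm.
  apply: (@le_trans _ _ (2 * `|C| * (lam i b ^+ 2 + lam i b * lam j b) / n)).
    by rewrite -[leRHS]mulrA ler_wpM2l ?mulr_ge0// mulrDl lerD2l.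
  rewrite ler_pM2r ?invr_gt0//; apply: (le_trans (hLa (i, j, b))).
  by rewrite expr2 ler_peMl ?ler0n// ler1n.
have Dle : D <= La.+1%:R / Num.sqrt n.
  apply: (le_trans (ler_norm _)).
  rewrite -ler_sqr ?nnegrE ?normr_ge0 ?divr_ge0 ?ler0n ?sqrtr_ge0//.
  by rewrite real_normK ?num_real.
by rewrite -lerBlDl.
Qed.

Hypothesis dominating : forall i b (La q nu0 : nat), exists nu, (nu0 < nu)%N /\
  forall j, j != i -> forall n, (nu <= q * n)%N ->
    La%:R / Num.sqrt nu%:R + (smean j b n - y j b) <= smean i b nu - y i b.

Theorem run_unbounded i b m : exists t, (m <= N t i b)%N.
Proof.
apply: contrapT => no.
have bnd t : (N t i b <= m)%N.
  by rewrite leqNgt; apply/negP => h; apply: no; exists t; exact: ltnW.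
have [C HC] := min_rate_bounded bnd.
have [q [La dom]] := sampled_dominated HC.
pose unb (x : 'I_k * 'I_B) := `[< forall m, exists t, (m < N t x.1 x.2)%N >].
have [x1 unb1] : exists x, unb x.
  apply: contrapT => nounb.
  have bx (x : 'I_k * 'I_B) : exists m, forall t, (N t x.1 x.2 <= m)%N.
    apply: contrapT => nb; apply: nounb; exists x; apply/asboolP => m'.
    apply: contrapT => nt; apply: nb; exists m' => t.
    by rewrite leqNgt; apply/negP => h; apply: nt; exists t.
  have /choice[f hf] := bx.
  pose s := (\sum_(i < k) \sum_(b < B) f (i, b))%N.
  have := total_run s.+1; rewrite leqNgt => /negP; apply; rewrite ltnS /Defs.total.
  by apply: leq_sum => i' _; apply: leq_sum => b' _; exact: (hf (i', b')).
(* Among the solutions sampled infinitely often at c, the one with the largest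
   mean contradicts [dominating]. *)
set c := x1.2.
have Pu : unb (x1.1, c) by rewrite /c -surjective_pairing.
case: (@arg_maxP _ _ _ x1.1 (fun j => unb (j, c)) (fun j => y j c) Pu) => a ua amax.
have /choice[f hf] : forall j, exists m, ~~ unb (j, c) -> forall t, (N t j c <= m)%N.
  move=> j; have [_|nu] := boolP (unb (j, c)); first by exists 0%N.
  apply: contrapT => nm; move/negP: nu; apply; apply/asboolP => m' /=.
  apply: contrapT => nt; apply: nm; exists m' => _ t.
  by rewrite leqNgt; apply/negP => h; apply: nt; exists t.
(* If [nu <= q * N t j c], then [nu > q * f j] excludes every [j] with bounded count; [nu > n0]
   makes [nu] a count through which [(a, c)] passes. *)
have [nu [nu0 hnu]] := dominating a c La.+1 q (n0 + \sum_(j < k) q * f j).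
have [t [Nt NSt]] : exists t, N t a c = nu /\ N t.+1 a c = nu.+1.
  apply: run_passes; first by apply: ltnW; apply: leq_ltn_trans nu0; exact: leq_addr.
  by have /asboolP/(_ nu)[t ht] := ua; exists t.
have [|j [ja qN Mj]] := dom t a c; first by rewrite NSt Nt.
have uj : unb (j, c).
  apply: contraT => nuj; have := hf j nuj t => Nf.
  move: qN; rewrite leqNgt => /negP[]; rewrite Nt; apply: leq_ltn_trans nu0.
  apply: (@leq_trans (q * f j)); first by rewrite leq_mul2l Nf orbT.
  by rewrite (bigD1 j)//= addnCA leq_addr.
have yj := amax j uj.
have := hnu j ja (N t j c); rewrite -{1}Nt => /(_ qN).
move: Mj; rewrite Nt => Mj.
have s0 : 0 < Num.sqrt nu%:R :> R.
  by rewrite sqrtr_gt0 ltr0n (leq_ltn_trans _ nu0).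
have : La%:R / Num.sqrt nu%:R < La.+1%:R / Num.sqrt nu%:R :> R.
  by rewrite ltr_pM2r ?invr_gt0// ltr_nat.
have yj' : y j c <= y a c := yj.
lra.
Qed.

End AllPairsSampled.

(** * Balance of the rates *)

Section Eventually.
Set Implicit Arguments.
Unset Strict Implicit.

Definition ev (Q : nat -> Prop) : Prop := exists T : nat, forall t, (T <= t)%N -> Q t.

Lemma ev_and (Q Q' : nat -> Prop) : ev Q -> ev Q' -> ev (fun t => Q t /\ Q' t).
Proof.
move=> [T hT] [T' hT']; exists (maxn T T') => t; rewrite geq_max => /andP[h h'].
by split; [exact: hT|exact: hT'].
Qed.

Lemma ev_imp (Q Q' : nat -> Prop) : (forall t, Q t -> Q' t) -> ev Q -> ev Q'.
Proof. by move=> QQ' [T hT]; exists T => t /hT/QQ'. Qed.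

Lemma ev_all (T : finType) (Q : T -> nat -> Prop) :
  (forall x, ev (Q x)) -> ev (fun t => forall x, Q x t).
Proof.
move=> /choice[f hf]; exists (\max_x f x) => t ft x; apply: hf.
by apply: leq_trans ft; exact: leq_bigmax.
Qed.

Lemma ev_inv (T : nat) (Q : nat -> Prop) : (exists2 t, (T <= t)%N & Q t) ->
  (forall t, (T <= t)%N -> Q t -> Q t.+1) -> ev Q.
Proof.
move=> [s Ts Qs] QS; exists s => t /subnKC <-; elim: (t - s)%N => [|m IHm].
  by rewrite addn0.
by rewrite addnS; apply: QS => //; rewrite (leq_trans Ts)// leq_addr.
Qed.

End Eventually.

Section Comparison.
Set Implicit Arguments.
Unset Strict Implicit.

(** Here [a], [b], [c] are the variances of [i], [j] and the best when [i] is selected, the primed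
    ones those when [j] is selected later; [x] and [y] are the numerators of the two weighted rates.
    Meanwhile [a] hardly moves, [b] shrinks by nearly [1 + e] and [c] by at most [1 + e], so the
    rate of [j] outgrows that of [i]. As [c] is at most [C] times [a] and [b], the margin is of
    order [e * a * b], which beats the errors in [eta]; hence [j] could not be the minimiser. *)
Lemma balance_contradiction (R : realFieldType)
     (a b c a' b' c' x y x' y' C e eta : R) :
  0 < a -> 0 < b -> 0 < c -> 0 < a' -> 0 < b' -> 0 < c' ->
  0 < x -> 0 < y -> 0 < x' -> 0 < y' -> 0 <= C ->
  0 < e -> e <= 1 -> 0 < eta -> eta * (100 * (1 + C) ^+ 2) = e ->
  c <= C * a -> c <= C * b ->
  a <= (1 + eta) * a' -> (1 + e) * b' <= (1 + eta) ^+ 2 * b ->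
  c <= (1 + e) * c' -> c' <= c ->
  y <= (1 + eta) * y' -> x' <= (1 + eta) * x ->
  x / (a + c) <= y / (b + c) -> y' / (b' + c') <= x' / (a' + c') -> False.
Proof.
move=> a0 b0 c0 a'0 b'0 c'0 x0 y0 x'0 y'0 C0 e0 e1 h0 hC ca cb aa bb cc cc' yy xx V V'.
have C1 : 1 <= (1 + C) ^+ 2 by rewrite expr_ge1//; lra.
have h1 : eta <= 1 by nra.
have h5 : (1 + eta) ^+ 5 <= 1 + 31 * eta.
  have p2 : eta ^+ 2 <= eta by rewrite expr2 ler_piMl// ltW.
  have p3 : eta ^+ 3 <= eta by rewrite exprS ler_piMr ?(ltW h0)// exprn_ile1 ?(ltW h0).
  have p4 : eta ^+ 4 <= eta by rewrite exprS ler_piMr ?(ltW h0)// exprn_ile1 ?(ltW h0).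
  have p5 : eta ^+ 5 <= eta by rewrite exprS ler_piMr ?(ltW h0)// exprn_ile1 ?(ltW h0).
  have -> : (1 + eta) ^+ 5 = 1 + 5 * eta + 10 * eta ^+ 2 + 10 * eta ^+ 3 + 5 * eta ^+ 4 + eta ^+ 5 by ring.
  lra.
have ac0 : 0 < a + c by rewrite addr_gt0.
have bc0 : 0 < b + c by rewrite addr_gt0.
have ac'0 : 0 < a' + c' by rewrite addr_gt0.
have bc'0 : 0 < b' + c' by rewrite addr_gt0.
have he0 : 0 < 1 + eta by lra.
have W : x * (b + c) <= y * (a + c).
  by move: V; rewrite ler_pdivrMr// mulrAC ler_pdivlMr.
have W' : y' * (a' + c') <= x' * (b' + c').
  by move: V'; rewrite ler_pdivrMr// mulrAC ler_pdivlMr.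
(* The product of the two minimality inequalities, in which the numerators cancel up to
   [(1 + eta) ^+ 2]. *)
have s2 : (b + c) * (a' + c') <= (1 + eta) ^+ 2 * ((a + c) * (b' + c')).
  have xy0 : 0 < x * y' by rewrite mulr_gt0.
  rewrite -(ler_pM2l xy0).
  apply: (@le_trans _ _ ((y * (a + c)) * (x' * (b' + c')))).
    rewrite [leLHS](_ : _ = (x * (b + c)) * (y' * (a' + c'))); last by ring.
    by apply: ler_pM => //; rewrite mulr_ge0// ltW.
  apply: (@le_trans _ _ (((1 + eta) * y' * (a + c)) * ((1 + eta) * x * (b' + c')))).
    apply: ler_pM; rewrite ?mulr_ge0 ?(ltW y0) ?(ltW x'0) ?(ltW ac0) ?(ltW bc'0)//.
      by rewrite ler_pM2r.
    by rewrite ler_pM2r.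
  by rewrite le_eqVlt; apply/orP; left; apply/eqP; ring.
have s3 : (1 + e) * ((b + c) * (a + c')) <= (1 + eta) ^+ 5 * ((a + c) * (b + (1 + e) * c')).
  have t1 : (b + c) * (a + c') <= (1 + eta) * ((b + c) * (a' + c')).
    rewrite mulrCA ler_pM2l//.
    have : 0 <= eta * c' by rewrite mulr_ge0// ltW.
    lra.
  have t2 : (1 + e) * (b' + c') <= (1 + eta) ^+ 2 * (b + (1 + e) * c').
    have : 1 <= (1 + eta) ^+ 2 by rewrite expr_ge1//; clear -h0; lra.
    move=> ee1; have ec : 0 <= (1 + e) * c' by rewrite mulr_ge0 ?(ltW c'0)//; clear -e0; lra.
    have : (1 + e) * c' <= (1 + eta) ^+ 2 * ((1 + e) * c') by rewrite ler_peMl.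
    lra.
  apply: (@le_trans _ _ ((1 + e) * ((1 + eta) * ((1 + eta) ^+ 2 * ((a + c) * (b' + c')))))).
    rewrite ler_pM2l; last lra.
    by apply: (le_trans t1); rewrite ler_pM2l.
  rewrite [leLHS](_ : _ = (1 + eta) ^+ 3 * (a + c) * ((1 + e) * (b' + c'))); last by ring.
  rewrite [leRHS](_ : _ = (1 + eta) ^+ 3 * (a + c) * ((1 + eta) ^+ 2 * (b + (1 + e) * c'))); last by ring.
  by rewrite ler_pM2l// mulr_gt0// exprn_gt0.
set Q := (a + c) * (b + (1 + e) * c') in s3.
(* The factors 31 and 62 / 100 come from (1 + eta) ^ 5 - 1 <= 31 eta. *)
have s4 : a * b * e <= (1 + e) * ((b + c) * (a + c')) - Q.
  have -> : (1 + e) * ((b + c) * (a + c')) - Q =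
    a * b * e + b * ((1 + e) * c' - c) + (1 + e) * a * (c - c') by rewrite /Q; ring.
  rewrite -addrA lerDl addr_ge0//.
    by rewrite mulr_ge0 ?(ltW b0)// subr_ge0.
  by rewrite !mulr_ge0 ?(ltW a0) ?subr_ge0//; lra.
have s5 : Q <= 2 * (1 + C) ^+ 2 * (a * b).
  have -> : 2 * (1 + C) ^+ 2 * (a * b) = ((1 + C) * a) * (2 * (1 + C) * b) by ring.
  have cc2 : (1 + e) * c' <= 2 * (C * b).
    by apply: ler_pM; [clear -e0; lra|exact: ltW|clear -e1; lra|exact: le_trans cb].
  have k1 : 0 <= b + (1 + e) * c' by rewrite addr_ge0 ?mulr_ge0 ?ltW//; clear -e0; lra.
  by apply: ler_pM => //; clear -ca cb cc2 C0 a0 c0 b0; lra.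
have ab0 : 0 < a * b by rewrite mulr_gt0.
have Q0 : 0 <= Q.
  by rewrite mulr_ge0 ?addr_ge0 ?mulr_ge0 ?(ltW a0) ?(ltW b0) ?(ltW c0) ?(ltW c'0)//; clear -e0; lra.
have s6 : (1 + eta) ^+ 5 * Q <= (1 + 31 * eta) * Q by rewrite ler_wpM2r.
have s7 : 31 * eta * Q <= 31 * eta * (2 * (1 + C) ^+ 2 * (a * b)).
  by rewrite ler_wpM2l// mulr_ge0// ltW.
have s8 : 31 * eta * (2 * (1 + C) ^+ 2 * (a * b)) = 62 / 100 * (e * (a * b)).
  by rewrite -hC; field.
have : 0 < e * (a * b) by rewrite mulr_gt0.
lra.
Qed.

End Comparison.

(** * Count processes driven by the exact bests and weights *)

Section BalanceDynamics.
Set Implicit Arguments.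
Unset Strict Implicit.
Context {R : realType} {k B : nat}.
Variables (lam : 'I_k -> 'I_B -> R) (ib : 'I_B -> 'I_k).
Variables (N : nat -> 'I_k -> 'I_B -> nat) (kap : nat -> 'I_k -> 'I_B -> R).
Variables (kinf : 'I_k -> 'I_B -> R) (T0 : nat).
Implicit Types (i j : 'I_k) (b c : 'I_B) (s t : nat).

Definition uvar t i b : R := lam i b ^+ 2 / (N t i b)%:R.
(* This is n W G, for n the total number of replications, which does not affect
   ratios; kap is W times half the squared gap of the sample means. *)
Definition wrate t i b : R := kap t i b / (uvar t i b + uvar t (ib b) b).
Definition best_sq t b : R := ((N t (ib b) b)%:R / lam (ib b) b) ^+ 2.
Definition rest_sq t b : R := \sum_(j | j != ib b) ((N t j b)%:R / lam j b) ^+ 2.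

Hypothesis k_gt1 : (1 < k)%N.
Hypothesis lam_gt0 : forall i b, 0 < lam i b.
Hypothesis N_gt0 : forall t i b, (0 < N t i b)%N.
Hypothesis N_unb : forall i b m, exists t, (m <= N t i b)%N.
Hypothesis N_step : forall t, (T0 <= t)%N -> exists i b, [/\ i != ib b,
    forall j c, j != ib c -> wrate t i b <= wrate t j c &
    N t.+1 = if best_sq t b < rest_sq t b then incr (N t) (ib b) b else incr (N t) i b].
Hypothesis N_leS : forall t i b, (N t i b <= N t.+1 i b)%N.
Hypothesis N_le_incr : forall t i b, (N t.+1 i b <= (N t i b).+1)%N.
Hypothesis kinf_gt0 : forall i b, i != ib b -> 0 < kinf i b.
Hypothesis kap_cvg : forall i b (e : R), i != ib b -> 0 < e ->
  ev (fun t => `|kap t i b - kinf i b| <= e).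

Lemma N_homo s t i b : (s <= t)%N -> (N s i b <= N t i b)%N.
Proof.
move=> /subnKC <-; elim: (t - s)%N => [|m IHm]; first by rewrite addn0.
by rewrite addnS; apply: leq_trans IHm (N_leS _ _ _).
Qed.

Lemma NR_gt0 t i b : 0 < (N t i b)%:R :> R. Proof. by rewrite ltr0n. Qed.

Lemma uvar_gt0 t i b : 0 < uvar t i b.
Proof. by rewrite divr_gt0 ?exprn_gt0// NR_gt0. Qed.

Lemma uvar_anti s t i b : (s <= t)%N -> uvar t i b <= uvar s i b.
Proof.
move=> st; rewrite ler_pM2l ?exprn_gt0// lef_pV2 ?posrE ?NR_gt0// ler_nat.
exact: N_homo.
Qed.

Lemma uvar_le (x : R) r s i b :
  (N s i b)%:R <= x * (N r i b)%:R -> uvar r i b <= x * uvar s i b.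
Proof.
move=> hx; rewrite /uvar ler_pdivrMr ?NR_gt0// [leRHS](_ : _ =
  lam i b ^+ 2 * (x * (N r i b)%:R / (N s i b)%:R)); last by ring.
by rewrite ler_peMr ?sqr_ge0// ler_pdivlMr ?NR_gt0// mul1r.
Qed.

Lemma N_ev_ge i b (x : R) : ev (fun t => x <= (N t i b)%:R).
Proof.
have [t ht] := N_unb i b (Num.truncn x).+1.
exists t => s /(@N_homo _ _ i b) ts; apply: ltW; apply: (lt_le_trans (truncnS_gt x)).
by rewrite ler_nat (leq_trans ht).
Qed.

Lemma N_passes i b n s : (N s i b <= n)%N ->
  exists t, [/\ (s <= t)%N, N t i b = n & N t.+1 i b = n.+1].
Proof.
move=> sn; have [t0] := N_unb i b n.+1.
elim: t0 => [|t IHt] nS.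
  by have := N_homo i b (leq0n s); rewrite leqNgt (leq_trans _ nS).
have [/IHt//|Nn] := ltnP n (N t i b).
have h1 := N_leS t i b; have h2 := N_le_incr t i b.
have Nt : N t i b = n by lia.
have NtS : N t.+1 i b = n.+1 by lia.
exists t; split => //; rewrite leqNgt; apply/negP => ts.
by have := N_homo i b ts; rewrite NtS leqNgt ltnS sn.
Qed.

Lemma N_sampled_after i b (T : nat) : exists2 t, (T <= t)%N & N t.+1 i b = (N t i b).+1.
Proof.
by have [t [Tt Nt NtS]] := N_passes (leqnn (N T i b)); exists t => //; rewrite Nt.
Qed.

Lemma N_sampledP t i b : (T0 <= t)%N -> N t.+1 i b = (N t i b).+1 ->
  (i = ib b /\ best_sq t b < rest_sq t b) \/
  [/\ i != ib b, rest_sq t b <= best_sq t b &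
    forall j c, j != ib c -> wrate t i b <= wrate t j c].
Proof.
move=> /N_step[i' [b' [ib' imin ->]]].
have incrP u v : incr (N t) u v i b = (N t i b).+1 -> i = u /\ b = v.
  rewrite /incr; case: andP => [[/eqP -> /eqP ->]//|_].
  by rewrite addn0 => /eqP; rewrite eqn_leq ltnn andbF.
case: ifPn => [cnd|] /=; first by move=> /incrP[-> ->]; left.
by rewrite -leNgt => cnd /incrP[-> ->]; right.
Qed.

Lemma other_solution b : exists i, i != ib b.
Proof.
have : (0 < #|predC1 (ib b)|)%N by rewrite cardC1 card_ord -subn1 subn_gt0.
by case/card_gt0P => i; exists i.
Qed.

Lemma sq_mono s t i b : (s <= t)%N ->
  ((N s i b)%:R / lam i b) ^+ 2 <= ((N t i b)%:R / lam i b) ^+ 2.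
Proof.
move=> st; rewrite ler_sqr ?nnegrE ?divr_ge0 ?ler0n ?(ltW (lam_gt0 _ _))//.
by rewrite ler_pM2r ?invr_gt0// ler_nat N_homo.
Qed.

(** The constant 3 comes from [(n + 1) ^+ 2 <= n ^+ 2 + 3 * n]. *)
Lemma sq_step (e : R) t i b : 0 < e -> e <= 1 -> 3 / e <= (N t i b)%:R ->
  ((N t.+1 i b)%:R / lam i b) ^+ 2 <= (1 + e) * ((N t i b)%:R / lam i b) ^+ 2.
Proof.
move=> e0 e1 Ne; have n0 := NR_gt0 t i b.
have nS : (N t.+1 i b)%:R <= (N t i b)%:R + 1 :> R by rewrite natr1 ler_nat.
have n1 : 0 <= (N t.+1 i b)%:R :> R by rewrite ler0n.
move: n0 Ne nS n1; set n := (N t i b)%:R; set n' := (N t.+1 i b)%:R => n0 Ne nS n1.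
rewrite !expr_div_n mulrA ler_pM2r ?invr_gt0 ?exprn_gt0//.
move: Ne; rewrite ler_pdivrMr// => Ne.
have : n' ^+ 2 <= (n + 1) ^+ 2 by rewrite ler_sqr ?nnegrE//; lra.
by nra.
Qed.

(** The square of the best grows only while it is below the rest, one replication overshoots by a
    factor at most [1 + e], and the rest never decreases. The bound is thus renewed at each sampling
    of the best and preserved in between. *)
Lemma best_le_rest (e : R) b : 0 < e -> e <= 1 ->
  ev (fun t => best_sq t b <= (1 + e) * rest_sq t b).
Proof.
move=> e0 e1; have [T1 hT1] := N_ev_ge (ib b) b (3 / e).
have rest_mono t : rest_sq t b <= rest_sq t.+1 b.
  by apply: ler_sum => j _; exact: sq_mono.
have hit t : (maxn T0 T1 <= t)%N -> N t.+1 (ib b) b = (N t (ib b) b).+1 ->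
    best_sq t.+1 b <= (1 + e) * rest_sq t.+1 b.
  rewrite geq_max => /andP[T0t T1t] /(N_sampledP T0t)[[_ lt]|[]]; last by rewrite eqxx.
  apply: (le_trans (sq_step e0 e1 (hT1 t T1t))).
  by rewrite ler_pM2l ?addr_gt0//; apply: ltW; apply: lt_le_trans lt _.
apply: (@ev_inv (maxn T0 T1)).
  have [t Tt inc] := N_sampled_after (ib b) b (maxn T0 T1).
  by exists t.+1; [exact: leqW|exact: hit].
move=> t Tt Qt; have [e'|ne] := eqVneq (N t.+1 (ib b) b) (N t (ib b) b).
  rewrite /best_sq e' -/(best_sq t b); apply: (le_trans Qt).
  by rewrite ler_pM2l ?addr_gt0.
by apply: hit => //; have := N_leS t (ib b) b; have := N_le_incr t (ib b) b; lia.
Qed.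

Lemma rest_le_best (e : R) b : 0 < e -> e <= 1 ->
  ev (fun t => rest_sq t b <= (1 + e) * best_sq t b).
Proof.
move=> e0 e1; have [T1 hT1] := ev_all (fun j => N_ev_ge j b (3 / e)).
have best_mono t : best_sq t b <= best_sq t.+1 b by exact: sq_mono.
have hit t j : (maxn T0 T1 <= t)%N -> j != ib b -> N t.+1 j b = (N t j b).+1 ->
    rest_sq t.+1 b <= (1 + e) * best_sq t.+1 b.
  rewrite geq_max => /andP[T0t T1t] jb /(N_sampledP T0t)[[jE]|[_ le _]].
    by rewrite jE eqxx in jb.
  apply: (@le_trans _ _ ((1 + e) * rest_sq t b)).
    rewrite /rest_sq mulr_sumr; apply: ler_sum => j' _.
    exact: (sq_step e0 e1 (hT1 t T1t j')).
  by rewrite ler_pM2l ?addr_gt0//; apply: (le_trans le).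
have [j jb] := other_solution b.
apply: (@ev_inv (maxn T0 T1)).
  have [t Tt inc] := N_sampled_after j b (maxn T0 T1).
  by exists t.+1; [exact: leqW|exact: (hit t j)].
move=> t Tt Qt.
have [[j' j'b inc]|none] := pselect (exists2 j', j' != ib b & N t.+1 j' b = (N t j' b).+1).
  exact: (hit t j').
have -> : rest_sq t.+1 b = rest_sq t b.
  apply: eq_bigr => j' j'b; congr ((_%:R / _) ^+ 2).
  have h1 := N_leS t j' b; have h2 := N_le_incr t j' b.
  have h3 : N t.+1 j' b <> (N t j' b).+1 by move=> h3; apply: none; exists j'.
  by move: h1 h2 h3; lia.
by apply: (le_trans Qt); rewrite ler_pM2l ?addr_gt0.
Qed.

(** By balance the best has a count at least comparable to each other one, so the variance of [i]
    governs the denominator of its rate. The reverse comparison comes only with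
    [comparable_from_best]. *)
Lemma best_uvar_le : exists2 C : R, 0 <= C &
  ev (fun t => forall i b, i != ib b -> uvar t (ib b) b <= C * uvar t i b).
Proof.
pose f (x : 'I_k * 'I_B) := 2 * lam (ib x.2) x.2 / lam x.1 x.2.
have f0 x : 0 <= f x by rewrite divr_ge0 ?mulr_ge0// ltW.
exists (\sum_x f x); first exact: sumr_ge0.
have [T hT] := ev_all (fun b => rest_le_best b ltr01 (lexx 1)).
exists T => t Tt i b ibb.
apply: (@le_trans _ _ (f (i, b) * uvar t i b)); last first.
  rewrite ler_pM2r ?uvar_gt0// (bigD1 (i, b))//= lerDl; exact: sumr_ge0.
have n0 := NR_gt0 t (ib b) b; have m0 := NR_gt0 t i b.
have l0 := lam_gt0 (ib b) b; have l1 := lam_gt0 i b.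
have : (N t i b)%:R / lam i b <= 2 * ((N t (ib b) b)%:R / lam (ib b) b).
  rewrite -ler_sqr ?nnegrE ?mulr_ge0 ?divr_ge0 ?invr_ge0 ?ler0n ?(ltW (lam_gt0 _ _))//.
  apply: (@le_trans _ _ (rest_sq t b)).
    by rewrite /rest_sq (bigD1 i)//= lerDl sumr_ge0// => j _; rewrite sqr_ge0.
  apply: (le_trans (hT t Tt b)); rewrite [leRHS]exprMn /best_sq ler_wpM2r ?sqr_ge0//.
  lra.
rewrite ler_pdivrMr// => h; rewrite /uvar /f /=.
rewrite [leRHS](_ : _ = lam (ib b) b ^+ 2 / (N t (ib b) b)%:R *
  (2 * ((N t (ib b) b)%:R / lam (ib b) b) * lam i b / (N t i b)%:R)); last first.
  by field; rewrite !gt_eqF.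
rewrite ler_peMr//; first by rewrite divr_ge0 ?sqr_ge0// ltW.
by rewrite ler_pdivlMr// mul1r.
Qed.

Lemma kap_ratio (e : R) : 0 < e -> e <= 1 -> exists T, forall s t i b,
  (T <= s)%N -> (T <= t)%N -> i != ib b ->
  [/\ 0 < kap s i b, kap s i b <= (1 + e) * kap t i b & kap s i b <= 2 * kinf i b].
Proof.
move=> e0 e1.
(* Relative error [e / 4] suffices since [(1 + e / 4) / (1 - e / 4) <= 1 + e]. The match makes the
   claim vacuous at the best pairs, for which no limit is assumed. *)
have [T hT] := @ev_all ('I_k * 'I_B)%type (fun x t => x.1 != ib x.2 ->
    `|kap t x.1 x.2 - kinf x.1 x.2| <= e * kinf x.1 x.2 / 4) (fun x =>
  match boolP (x.1 != ib x.2) with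
  | AltTrue h => ev_imp (fun t Q _ => Q) (kap_cvg h
      (divr_gt0 (mulr_gt0 e0 (kinf_gt0 h)) (ltr0n R 4)))
  | AltFalse h => ex_intro _ 0%N (fun t _ h' => False_ind _ (negP h h'))
  end).
exists T => s t i b Ts Tt ibb; have k0 := kinf_gt0 ibb.
have := hT s Ts (i, b) ibb; have := hT t Tt (i, b) ibb; rewrite /= !ler_norml.
move=> /andP[t1 t2] /andP[s1 s2].
have ek : e * kinf i b <= kinf i b by rewrite ler_piMl// ltW.
have ek0 : 0 < e * kinf i b by rewrite mulr_gt0.
by split; nra.
Qed.

(* Let N s i be sampled at s and not again before t. If the count of the best
   grew by a factor 1 + e, then by the balance rule so did the count of some j,
   last sampled at r say; comparing (i, b) and (j, b) at times s and r is
   contradictory. *)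
Lemma best_growth (e : R) i b : 0 < e -> e <= 1 -> i != ib b ->
  exists T, forall s t, (T <= s)%N -> (s < t)%N ->
    N s.+1 i b = (N s i b).+1 -> N t i b = (N s i b).+1 ->
    (N t (ib b) b)%:R <= (1 + e) * (N s (ib b) b)%:R :> R.
Proof.
move=> e0 e1 ibb; pose g := 1 + e.
have gE : g = 1 + e by [].
have g1 : 1 < g by lra.
have [C C0 hC] := best_uvar_le.
(* One tolerance for the balance, for [kap] and for the effect of a single replication, in the form
   required by [balance_contradiction]. *)
pose eta := e / (100 * (1 + C) ^+ 2).
have C1 : 1 <= (1 + C) ^+ 2 by rewrite expr_ge1//; lra.
have D0 : 0 < 100 * (1 + C) ^+ 2 by lra.
have eta0 : 0 < eta by rewrite divr_gt0.
have etaC : eta * (100 * (1 + C) ^+ 2) = e by rewrite /eta divfK// gt_eqF.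
have eta_e : 100 * eta <= e by nra.
have eta1 : eta <= 1 by lra.
have [T1 hT1] := ev_and hC (ev_and (ev_and (best_le_rest b eta0 eta1) (rest_le_best b eta0 eta1))
  (ev_all (fun j => N_ev_ge j b (3 / eta)))).
have [T2 hT2] := kap_ratio eta0 eta1.
exists (maxn T0 (maxn T1 T2)) => s t; rewrite !geq_max => /andP[T0s /andP[T1s T2s]] st incs Nit.
rewrite leNgt; apply/negP => big.
(* The first time at which the count of the best has grown by the factor [g]; minimality bounds its
   growth at the earlier time [r] below. *)
have [t' [st' t't big' small']] : exists t', [/\ (s < t')%N, (t' <= t)%N,
    g * (N s (ib b) b)%:R <= (N t' (ib b) b)%:R &
    forall r, (r < t')%N -> (N r (ib b) b)%:R < g * (N s (ib b) b)%:R].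
  pose Q r := g * (N s (ib b) b)%:R <= (N r (ib b) b)%:R.
  have Qt : exists r, Q r by exists t; exact: ltW.
  have [r Qr rmin] := ex_minnP Qt.
  exists r; split => //.
  - rewrite ltnNge; apply/negP => rs; move: Qr; rewrite /Q leNgt => /negP; apply.
    apply: (@le_lt_trans _ _ (N s (ib b) b)%:R); first by rewrite ler_nat N_homo.
    by rewrite ltr_pMl ?NR_gt0.
  - by apply: rmin; exact: ltW.
  - by move=> r' r'r; rewrite ltNge; apply/negP => /rmin; rewrite leqNgt r'r.
have T1t' : (T1 <= t')%N by exact: leq_trans T1s (ltnW st').
have [hCs [[bs rs] Ns]] := hT1 s T1s.
have [_ [[bt rt] _]] := hT1 t' T1t'.
have Nit' : N t' i b = (N s i b).+1.
  by apply/eqP; rewrite eqn_leq -{1}Nit N_homo// -incs N_homo.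
have l1 j := lam_gt0 j b.
(* If all other counts grew by less than [h], the balance at [s] and at [t'], each accurate up to
   [1 + eta], would keep the growth of the best below [h * (1 + eta) = g]. *)
pose h := g / (1 + eta).
have ee0 : 0 < 1 + eta by lra.
have h1 : 1 < h by rewrite /h ltr_pdivlMr; lra.
have [j jb jbig] : exists2 j, j != ib b & h * (N s j b)%:R <= (N t' j b)%:R.
  apply: contrapT => no.
  have lt : rest_sq t' b < h ^+ 2 * rest_sq s b.
    rewrite /rest_sq mulr_sumr; apply: ltr_sum; first by apply/hasP; exists i; rewrite ?mem_index_enum.
    move=> j jb; rewrite -exprMn ltr_sqr ?nnegrE; last 2 first.
    - by rewrite divr_ge0 ?ler0n// ltW.
    - by rewrite mulr_ge0 ?divr_ge0 ?ler0n ?(ltW (l1 _))//; lra.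
    rewrite mulrA ltr_pM2r ?invr_gt0// ltNge; apply/negP => jh.
    by apply: no; exists j.
  have ge : g ^+ 2 * best_sq s b <= best_sq t' b.
    rewrite /best_sq -exprMn mulrA ler_sqr ?nnegrE ?divr_ge0 ?mulr_ge0 ?invr_ge0 ?ler0n ?(ltW (l1 _))//; last lra.
    by rewrite ler_pM2r ?invr_gt0.
  have hE : h ^+ 2 * (1 + eta) ^+ 2 = g ^+ 2 by rewrite -exprMn /h divfK// gt_eqF//; lra.
  have bs0 : 0 <= best_sq s b by rewrite sqr_ge0.
  have g20 : 0 <= g ^+ 2 by rewrite sqr_ge0.
  have x1 : (1 + eta) * rest_sq t' b < (1 + eta) * (h ^+ 2 * rest_sq s b).
    by rewrite ltr_pM2l//; lra.
  have x2 : h ^+ 2 * ((1 + eta) * rest_sq s b) <= h ^+ 2 * ((1 + eta) * ((1 + eta) * best_sq s b)).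
    by rewrite ler_wpM2l ?sqr_ge0// ler_wpM2l//; lra.
  have x3 : h ^+ 2 * ((1 + eta) * ((1 + eta) * best_sq s b)) = g ^+ 2 * best_sq s b.
    by rewrite -hE; ring.
  have x4 : (1 + eta) * (h ^+ 2 * rest_sq s b) = h ^+ 2 * ((1 + eta) * rest_sq s b) by ring.
  lra.
have inc_small j' r : (s <= r)%N -> (N r.+1 j' b)%:R <= (1 + eta) * (N r j' b)%:R :> R.
  move=> sr; apply: (@le_trans _ _ ((N r j' b)%:R + 1)).
    by rewrite natr1 ler_nat.
  have : 3 / eta <= (N r j' b)%:R.
    by apply: le_trans (Ns j') _; rewrite ler_nat N_homo.
  by rewrite ler_pdivrMr// => ?; lra.
have ji : j != i.
  apply/eqP => jE; move: jbig; rewrite jE Nit' leNgt => /negP; apply.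
  rewrite -incs; apply: (le_lt_trans (inc_small i s (leqnn s))).
  rewrite ltr_pM2r ?NR_gt0// /h ltr_pdivlMr; last lra.
  rewrite /g; nra.
have Njlt : (N s j b < N t' j b)%N.
  rewrite -(ltr_nat R); apply: lt_le_trans jbig; rewrite ltr_pMl ?NR_gt0//.
have [r [sr Nr NrS]] : exists r, [/\ (s <= r)%N, N r j b = (N t' j b).-1 & N r.+1 j b = N t' j b].
  have [|r [sr Nr NrS]] := @N_passes j b (N t' j b).-1 s.
    by rewrite -ltnS prednK.
  by exists r; split => //; rewrite NrS prednK.
have rt' : (r < t')%N.
  rewrite ltnNge; apply/negP => /(N_homo j b); rewrite Nr.
  by rewrite leqNgt ltn_predL N_gt0.
have T0r : (T0 <= r)%N by exact: leq_trans T0s sr.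
have T2r : (T2 <= r)%N by exact: leq_trans T2s sr.
have [[iE]|[_ _ mins]] := N_sampledP T0s incs; first by rewrite iE eqxx in ibb.
have [|[jE]|[_ _ minr]] := @N_sampledP r j b T0r; first by rewrite NrS Nr prednK.
  by rewrite jE eqxx in jb.
have Vs := mins j b jb; have Vr := minr i b ibb.
have NiS : (N r i b <= (N s i b).+1)%N by rewrite -Nit' N_homo// ltnW.
have [x_gt0 _ _] := hT2 s s i b T2s T2s ibb.
have [x'_gt0 xx' _] := hT2 r s i b T2r T2s ibb.
have [y_gt0 yy' _] := hT2 s r j b T2s T2r jb.
have [y'_gt0 _ _] := hT2 r r j b T2r T2r jb.
apply: (balance_contradiction (uvar_gt0 s i b) (uvar_gt0 s j b) (uvar_gt0 s (ib b) b)
  (uvar_gt0 r i b) (uvar_gt0 r j b) (uvar_gt0 r (ib b) b) x_gt0 y_gt0 x'_gt0 y'_gt0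
  C0 e0 e1 eta0 etaC (hCs i b ibb) (hCs j b jb) _ _ _ _ yy' xx' Vs Vr).
- by apply: uvar_le; apply: le_trans (inc_small i s (leqnn s)); rewrite incs ler_nat.
- have : g * (N s j b)%:R <= (1 + eta) ^+ 2 * (N r j b)%:R.
    have := inc_small j r sr; rewrite NrS => c1.
    have : (1 + eta) * (h * (N s j b)%:R) <= (1 + eta) * ((1 + eta) * (N r j b)%:R).
      by rewrite ler_pM2l//; exact: le_trans jbig c1.
    have -> : (1 + eta) * (h * (N s j b)%:R) = g * (N s j b)%:R.
      by rewrite mulrA [_ * h]mulrC /h divfK// gt_eqF.
    by rewrite mulrA -expr2.
  move=> hg; rewrite -/g /uvar mulrA ler_pdivrMr ?NR_gt0//.
  rewrite [leRHS](_ : _ = lam j b ^+ 2 * ((1 + eta) ^+ 2 * (N r j b)%:R / (N s j b)%:R)); last by ring.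
  by rewrite mulrC ler_pM2l ?exprn_gt0// ler_pdivlMr ?NR_gt0.
- by apply: uvar_le; apply: ltW; exact: small'.
- exact: uvar_anti.
Qed.

(** The cube collects three errors since the last selection of [(i, b)]: the change of [kap] for
    each of the two pairs, and the decrease of the variances of [i] and of its best. The variances
    of [(j, c)] cost nothing, as they only decrease. *)
Lemma wrate_balanced (e : R) : 0 < e -> e <= 1 ->
  ev (fun t => forall i b j c, i != ib b -> j != ib c ->
    wrate t i b <= (1 + e) ^+ 3 * wrate t j c).
Proof.
move=> e0 e1; have ee0 : 0 < 1 + e by rewrite addr_gt0.
suff /ev_all : forall x : 'I_k * 'I_B, ev (fun t => x.1 != ib x.2 -> forall j c, j != ib c ->
    wrate t x.1 x.2 <= (1 + e) ^+ 3 * wrate t j c).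
  by apply: ev_imp => t h i b j c ibb; exact: (h (i, b)).
case=> i b /=; have [ibb|_] := boolP (i != ib b); last by exists 0%N.
have [T1 hT1] := best_growth e0 e1 ibb.
have [T2 hT2] := kap_ratio e0 e1.
have [T3 hT3] := N_ev_ge i b e^-1.
pose T := maxn T0 (maxn T1 (maxn T2 T3)).
have [s0 Ts0 incs0] := N_sampled_after i b T.
exists s0.+1 => t s0t _ j c jc.
have NTt : (N T i b < N t i b)%N.
  apply: leq_trans (N_homo i b s0t); rewrite incs0 ltnS; exact: N_homo.
have [s [Ts Ns NsS]] : exists s, [/\ (T <= s)%N, N s i b = (N t i b).-1 & N s.+1 i b = N t i b].
  have Nt1 : (N T i b <= (N t i b).-1)%N by rewrite -ltnS prednK.
  by have [s [Ts Ns NsS]] := N_passes Nt1; exists s; split => //; rewrite NsS prednK.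
have Nt : N t i b = (N s i b).+1 by rewrite Ns prednK.
have incs : N s.+1 i b = (N s i b).+1 by rewrite NsS.
have st : (s < t)%N.
  by rewrite ltnNge; apply/negP => /(N_homo i b); rewrite Nt ltnn.
move: Ts; rewrite !geq_max => /and4P[T0s T1s T2s T3s].
have T2t : (T2 <= t)%N by exact: leq_trans T2s (ltnW st).
have [[iE]|[_ _ mins]] := N_sampledP T0s incs; first by rewrite iE eqxx in ibb.
have grow := hT1 s t T1s st incs Nt.
have [kt0 kts _] := hT2 t s i b T2t T2s ibb.
have [ks0 kst _] := hT2 s t j c T2s T2t jc.
have [ks0' _ _] := hT2 s t i b T2s T2t ibb.
have [kt0' _ _] := hT2 t s j c T2t T2s jc.
have ui : uvar s i b <= (1 + e) * uvar t i b.
  apply: uvar_le; rewrite Nt -natr1 mulrDl mul1r lerD2l.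
  have := hT3 s T3s; rewrite -(ler_pM2l e0) divff ?gt_eqF//.
have us : uvar s (ib b) b <= (1 + e) * uvar t (ib b) b by exact: uvar_le.
have D0 r u v : 0 < uvar r u v + uvar r (ib v) v by rewrite addr_gt0 ?uvar_gt0.
have a1 : wrate t i b <= (1 + e) ^+ 2 * wrate s i b.
  rewrite /wrate ler_pdivrMr// [leRHS](_ : _ = (1 + e) ^+ 2 * kap s i b *
    (uvar t i b + uvar t (ib b) b) / (uvar s i b + uvar s (ib b) b)); last by ring.
  rewrite ler_pdivlMr//.
  apply: (@le_trans _ _ ((1 + e) * kap s i b * ((1 + e) * (uvar t i b + uvar t (ib b) b)))).
    apply: ler_pM => //; [exact: ltW|exact: ltW|by rewrite mulrDr lerD].
  by rewrite le_eqVlt; apply/orP; left; apply/eqP; ring.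
have a2 : wrate s j c <= (1 + e) * wrate t j c.
  rewrite /wrate ler_pdivrMr// [leRHS](_ : _ = (1 + e) * kap t j c *
    (uvar s j c + uvar s (ib c) c) / (uvar t j c + uvar t (ib c) c)); last by ring.
  rewrite ler_pdivlMr//; apply: ler_pM => //; [exact: ltW|exact: ltW|].
  by apply: lerD; apply: uvar_anti; exact: ltnW.
apply: (le_trans a1); rewrite [in leRHS]exprSr -[leRHS]mulrA ler_pM2l ?exprn_gt0//.
exact: le_trans (mins j c jc) a2.
Qed.

Definition comparable_counts i b j c : Prop :=
  exists2 K : R, 0 <= K & ev (fun t => (N t i b)%:R <= K * (N t j c)%:R).

Lemma comparable_trans i b j c j' c' :
  comparable_counts i b j c -> comparable_counts j c j' c' -> comparable_counts i b j' c'.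
Proof.
move=> [K K0 hK] [K' K'0 hK']; exists (K * K'); first exact: mulr_ge0.
apply: ev_imp (ev_and hK hK') => t [h h'].
by apply: (le_trans h); rewrite -mulrA ler_wpM2l.
Qed.

(** By [best_uvar_le] a weighted rate lies between constant multiples of the count of its own pair.
    Balance with [e = 1], that is within the factor 8, transfers this to the counts. *)
Lemma comparable_nonbest i b j c : i != ib b -> j != ib c -> comparable_counts i b j c.
Proof.
move=> ibb jc; have [C C0 hC] := best_uvar_le.
have [T hT] := kap_ratio (@ltr01 R) (lexx 1).
have [ki0 _ _] := hT T T i b (leqnn _) (leqnn _) ibb.
have kj0 := kinf_gt0 jc; have li := lam_gt0 i b; have lj := lam_gt0 j c.
exists ((2 * (1 + C) * lam i b ^+ 2 / kap T i b) * (8 * (2 * kinf j c / lam j c ^+ 2))).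
  by apply: mulr_ge0; [apply: divr_ge0; [apply: mulr_ge0; rewrite ?sqr_ge0//; lra|exact: ltW]|
    apply: mulr_ge0 => //; apply: divr_ge0; rewrite ?sqr_ge0//; lra].
have hT' : ev (fun t => (T <= t)%N) by exists T.
apply: ev_imp (ev_and hT' (ev_and hC (wrate_balanced (@ltr01 R) (lexx 1)))) => t [Tt [hCt bal]].
have [_ kT _] := hT T t i b (leqnn _) Tt ibb.
have [kt0 _ kt2] := hT t t j c Tt Tt jc.
have n0 := NR_gt0 t i b; have m0 := NR_gt0 t j c.
have u0 := uvar_gt0 t i b; have v0 := uvar_gt0 t j c.
have us0 := uvar_gt0 t (ib b) b; have vs0 := uvar_gt0 t (ib c) c.
have C1 : 0 < 1 + C by lra.
have lower : kap T i b / 2 / ((1 + C) * uvar t i b) <= wrate t i b.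
  have d1 : 0 < (1 + C) * uvar t i b by rewrite mulr_gt0.
  have d2 : 0 < uvar t i b + uvar t (ib b) b by rewrite addr_gt0.
  apply: ler_pM.
  - by rewrite divr_ge0// ltW.
  - by rewrite invr_ge0 ltW.
  - by rewrite ler_pdivrMr// mulrC.
  - by rewrite lef_pV2 ?posrE// mulrDl mul1r lerD2l hCt.
have upper : wrate t j c <= 2 * kinf j c / uvar t j c.
  have d2 : 0 < uvar t j c + uvar t (ib c) c by rewrite addr_gt0.
  apply: ler_pM => //; first exact: ltW.
    by rewrite invr_ge0 ltW.
  by rewrite lef_pV2 ?posrE// lerDl ltW.
have : kap T i b / 2 / ((1 + C) * uvar t i b) <= 8 * (2 * kinf j c / uvar t j c).
  apply: (le_trans lower); apply: (le_trans (bal i b j c ibb jc)).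
  have -> : (1 + 1) ^+ 3 = 8 :> R by ring.
  by rewrite ler_pM2l.
rewrite -(ler_pM2l (_ : 0 < 2 * (1 + C) * lam i b ^+ 2 / kap T i b)); last first.
  by rewrite divr_gt0// !mulr_gt0 ?exprn_gt0.
rewrite /uvar => h.
have e1 : 2 * (1 + C) * lam i b ^+ 2 / kap T i b *
  (kap T i b / 2 / ((1 + C) * (lam i b ^+ 2 / (N t i b)%:R))) = (N t i b)%:R.
  by field; rewrite !gt_eqF.
rewrite e1 in h; apply: (le_trans h); rewrite le_eqVlt; apply/orP; left; apply/eqP.
by field; rewrite !gt_eqF.
Qed.

Lemma comparable_to_best i b : i != ib b -> comparable_counts i b (ib b) b.
Proof.
move=> ibb; have [C C0 hC] := best_uvar_le.
have li := lam_gt0 i b; have ls := lam_gt0 (ib b) b.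
exists (C * lam i b ^+ 2 / lam (ib b) b ^+ 2).
  by rewrite divr_ge0 ?sqr_ge0// mulr_ge0 ?sqr_ge0.
apply: ev_imp hC => t /(_ i b ibb).
have n0 := NR_gt0 t i b; have m0 := NR_gt0 t (ib b) b.
rewrite /uvar ler_pdivrMr// => h.
rewrite mulrAC ler_pdivlMr ?exprn_gt0// mulrC -ler_pdivlMr//.
apply: (le_trans h); rewrite le_eqVlt; apply/orP; left; apply/eqP.
by field; rewrite !gt_eqF.
Qed.

Lemma comparable_from_best i b : i != ib b -> comparable_counts (ib b) b i b.
Proof.
move=> ibb.
have /choice[K hK] : forall j, exists K : R, 0 <= K /\ (j != ib b -> ev (fun t => (N t j b)%:R <= K * (N t i b)%:R)).
  move=> j; have [jb|_] := boolP (j != ib b); last by exists 0.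
  by have [K K0 hK] := comparable_nonbest jb ibb; exists K.
(* The added 1 gives [L <= L ^+ 2], so a bound on squares by [L] also bounds the counts by [L]. *)
pose L := 1 + 2 * lam (ib b) b ^+ 2 * \sum_(j | j != ib b) (K j / lam j b) ^+ 2.
have S0 : 0 <= \sum_(j | j != ib b) (K j / lam j b) ^+ 2 by apply: sumr_ge0 => j _; rewrite sqr_ge0.
have L1 : 1 <= L by rewrite /L lerDl; apply: mulr_ge0 => //; apply: mulr_ge0; rewrite ?sqr_ge0.
exists L; first exact: le_trans L1.
have hK' : ev (fun t => forall j, j != ib b -> (N t j b)%:R <= K j * (N t i b)%:R).
  apply: ev_all => j; have [jb|_] := boolP (j != ib b); last by exists 0%N.
  by apply: ev_imp (proj2 (hK j) jb) => t.
apply: ev_imp (ev_and hK' (best_le_rest b (@ltr01 R) (lexx 1))) => t [Kt bt].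
have n0 := NR_gt0 t i b; have m0 := NR_gt0 t (ib b) b.
have ls := lam_gt0 (ib b) b.
have rt : rest_sq t b <= (\sum_(j | j != ib b) (K j / lam j b) ^+ 2) * (N t i b)%:R ^+ 2.
  rewrite mulr_suml; apply: ler_sum => j jb; rewrite -exprMn.
  rewrite ler_sqr ?nnegrE.
  - by rewrite mulrAC ler_pM2r ?invr_gt0// Kt.
  - by rewrite divr_ge0// ltW.
  - by rewrite mulr_ge0// divr_ge0 ?(proj1 (hK j))// ltW.
have sq : (N t (ib b) b)%:R ^+ 2 <= L * (N t i b)%:R ^+ 2.
  move: bt; rewrite /best_sq expr_div_n ler_pdivrMr ?exprn_gt0// => bt.
  apply: (le_trans bt); rewrite /L.
  have : rest_sq t b * lam (ib b) b ^+ 2 <=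
      (\sum_(j | j != ib b) (K j / lam j b) ^+ 2) * (N t i b)%:R ^+ 2 * lam (ib b) b ^+ 2.
    by rewrite ler_pM2r ?exprn_gt0.
  have : 0 <= (N t i b)%:R ^+ 2 :> R by rewrite sqr_ge0.
  lra.
rewrite -ler_sqr ?nnegrE ?mulr_ge0 ?(ltW n0) ?(ltW m0) ?(le_trans ler01 L1)//.
apply: (le_trans sq); rewrite exprMn ler_wpM2r ?sqr_ge0// expr2 ler_peMl//.
exact: le_trans L1.
Qed.

Theorem counts_comparable i b j c : comparable_counts i b j c.
Proof.
have [i' i'b] := other_solution b; have [j' j'c] := other_solution c.
have h1 : comparable_counts i b i' b.
  have [ibb|/negPn/eqP ->] := boolP (i != ib b); first exact: comparable_nonbest.
  exact: comparable_from_best.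
have h2 : comparable_counts j' c j c.
  have [jc|/negPn/eqP ->] := boolP (j != ib c); first exact: comparable_nonbest.
  exact: comparable_to_best.
by apply: comparable_trans h1 (comparable_trans _ h2); exact: comparable_nonbest.
Qed.

End BalanceDynamics.

(** * From count processes back to the algorithm *)

Section RunBalance.
Set Implicit Arguments.
Unset Strict Implicit.
Context {R : realType} {k B : nat}.
Variables (p : 'I_B -> R) (y lam : 'I_k -> 'I_B -> R) (n0 : nat) (acc : bool).
Variables (ib : 'I_B -> 'I_k) (istar : 'I_k).
Hypothesis k_gt1 : (1 < k)%N.
Hypothesis n0_gt0 : (0 < n0)%N.
Hypothesis p_gt0 : forall b, 0 < p b.
Hypothesis p_sum : \sum_(b < B) p b = 1.
Hypothesis lam_gt0 : forall i b, 0 < lam i b.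
Hypothesis ib_uniq : forall b j, j != ib b -> y (ib b) b < y j b.
Hypothesis istar_uniq : forall j, j != istar -> mass p ib j < mass p ib istar.
Variable obs : 'I_k -> 'I_B -> nat -> R.
Hypothesis slln : forall i b (e : R), 0 < e ->
  exists m, forall n, (m <= n)%N -> `|smean obs i b n - y i b| <= e.
Hypothesis dominating : forall i b (La q nu0 : nat), exists nu, (nu0 < nu)%N /\
  forall j, j != i -> forall n, (nu <= q * n)%N ->
    La%:R / Num.sqrt nu%:R + (smean obs j b n - y j b) <= smean obs i b nu - y i b.

Local Notation N := (run p lam acc n0 obs).
Local Notation W := (Wrule p ib istar acc).

Let N_gt0 t i b : (0 < N t i b)%N.
Proof. exact: run_gt0. Qed.
Let N_unb i b m : exists t, (m <= N t i b)%N.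
Proof. exact: (run_unbounded acc k_gt1 n0_gt0 p_gt0 p_sum lam_gt0 istar slln dominating). Qed.
Let N_leS t i b : (N t i b <= N t.+1 i b)%N.
Proof. exact: (run_leS lam acc k_gt1 n0_gt0 p_sum obs istar). Qed.
Let N_le_incr t i b : (N t.+1 i b <= (N t i b).+1)%N.
Proof. exact: (run_le_incr lam acc k_gt1 n0_gt0 p_sum obs istar). Qed.

Let mean_t t i b : R := smean obs i b (N t i b).

Lemma ev_mean i b (e : R) : 0 < e -> ev (fun t => `|mean_t t i b - y i b| <= e).
Proof.
move=> e0; have [m hm] := slln i b e0; have [T hT] := N_unb i b m.
by exists T => t Tt; apply: hm; apply: leq_trans hT (N_homo N_leS _ _ Tt).
Qed.

Lemma mean_cvg i b : mean_t t i b @[t --> \oo] --> y i b.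
Proof.
apply/cvgrPdist_le => e e0; have [T hT] := ev_mean i b e0.
by exists T => // t /= Tt; rewrite distrC; exact: hT.
Qed.

Lemma ev_ebest : ev (fun t => ebestd obs (N t) istar = ib).
Proof.
suff /ev_all : forall x : 'I_k * 'I_B, ev (fun t => x.1 != ib x.2 ->
    mean_t t (ib x.2) x.2 < mean_t t x.1 x.2).
  apply: ev_imp => t h; apply/funext => b; apply/eqP; apply: contraT => ne.
  have := h (_, b) ne; rewrite ltNge => /negP[].
  exact: (ebestdP obs (N t) istar b (ib b)).
case=> j b /=; have [jb|_] := boolP (j != ib b); last by exists 0%N.
pose e := (y j b - y (ib b) b) / 3.
have gap := ib_uniq jb.
have e0 : 0 < e by rewrite divr_gt0// subr_gt0.
apply: ev_imp (ev_and (ev_mean j b e0) (ev_mean (ib b) b e0)) => t [].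
rewrite !ler_norml /e => /andP[h1 h2] /andP[h3 h4] _; lra.
Qed.

Definition kap_t t i b : R := W i b * (mean_t t i b - mean_t t (ib b) b) ^+ 2 / 2.
Definition kap_lim i b : R := W i b * (y i b - y (ib b) b) ^+ 2 / 2.

Lemma W_gt0 i b : 0 < W i b.
Proof. exact: lt_le_trans ltr01 (Wrule_ge1 _ _ _ _ _ _). Qed.

Lemma kap_lim_gt0 i b : i != ib b -> 0 < kap_lim i b.
Proof.
move=> ibb; rewrite divr_gt0// mulr_gt0 ?W_gt0// exprn_gt0// subr_gt0.
exact: ib_uniq.
Qed.

Lemma kap_t_cvg i b (e : R) : i != ib b -> 0 < e ->
  ev (fun t => `|kap_t t i b - kap_lim i b| <= e).
Proof.
move=> _ e0.
have : kap_t t i b @[t --> \oo] --> kap_lim i b.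
  apply: cvgM; last exact: cvg_cst.
  apply: cvgM; first exact: cvg_cst.
  by rewrite !expr2; under eq_fun do rewrite expr2; apply: cvgM; apply: cvgB; exact: mean_cvg.
move=> /cvgrPdist_le/(_ e e0)[T _ hT].
by exists T => t Tt; rewrite distrC; exact: hT.
Qed.

(** Once the conditional bests are right, [istar] is the only maximiser of the mass, so the
    tie-breaking rule no longer matters and the plug-in weights are exact. The formula for [G]
    translates [wrate] back into sample rates. *)
Lemma run_dynamics : exists T0, forall t, (T0 <= t)%N ->
  (forall i b, G lam obs (N t) i b = wrate lam ib N kap_t t i b / W i b / (Defs.total (N t))%:R) /\
  exists i b, [/\ i != ib b,
    forall j c, j != ib c -> wrate lam ib N kap_t t i b <= wrate lam ib N kap_t t j c &
    N t.+1 = if best_sq lam ib N t b < rest_sq lam ib N t b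
             then incr (N t) (ib b) b else incr (N t) i b].
Proof.
have [T0 hT0] := ev_ebest; exists T0 => t /hT0 bt.
have star : estard p lam obs (N t) istar = istar.
  apply/eqP; apply: contraT => /istar_uniq.
  by have := estardP p lam obs (N t) istar istar; rewrite bt leNgt => /negP.
have wE i b : W i b * rate lam obs (N t) istar i b = wrate lam ib N kap_t t i b.
  by rewrite /rate bt /wrate /kap_t /uvar !mean_run invfM !mulrA.
split.
  move=> i b; rewrite (GE lam obs istar)//.
  by rewrite -wE [W i b * _]mulrC mulfK// gt_eqF// W_gt0.
have [i [b [ibb imin NS]]] := runP lam acc k_gt1 n0_gt0 p_sum obs istar t.
move: ibb imin NS; rewrite bt star => ibb imin NS; exists i, b; split => //.
by move=> j c jc; rewrite -!wE; exact: imin.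
Qed.

Lemma total_gt0R t (b : 'I_B) : 0 < (Defs.total (N t))%:R :> R.
Proof. by rewrite ltr0n (total_gt0 (N_gt0 t istar b)). Qed.

Lemma count_le_total t i b : (N t i b <= Defs.total (N t))%N.
Proof. by rewrite /Defs.total (bigD1 i)//= (bigD1 b)//= -addnA leq_addr. Qed.

Theorem run_balance :
  [/\ (forall b : 'I_B,
         (fun t => (alpha R (N t) (ib b) b / lam (ib b) b) ^+ 2
                   - \sum_(j | j != ib b) (alpha R (N t) j b / lam j b) ^+ 2)
         @ \oo --> (0 : R)),
      (forall (i : 'I_k) (b : 'I_B) (j : 'I_k) (c : 'I_B),
         inDom ib istar i b -> inDom ib istar j c ->
         (fun t => (W i b * G lam obs (N t) i b) / (W j c * G lam obs (N t) j c))
         @ \oo --> (1 : R))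
    & (forall (i : 'I_k) (b : 'I_B) (j : 'I_k) (c : 'I_B),
         (limn_esup (fun t => ((N t i b)%:R / (N t j c)%:R : R)%:E) < +oo)%E)].
Proof.
have [T0 hT0] := run_dynamics.
have N_step t (Tt : (T0 <= t)%N) := proj2 (hT0 t Tt).
split.
- move=> b; apply/cvgrPdist_le => eps eps0.
  have ls := lam_gt0 (ib b) b.
  (* The two squares differ by at most [2 * e] times that of the best, which is itself at most the
     squared total over [lam (ib b) b ^+ 2]. *)
  pose e := Num.min 1 (eps * lam (ib b) b ^+ 2 / 2).
  have e0 : 0 < e by rewrite lt_min ltr01 divr_gt0// mulr_gt0// exprn_gt0.
  have e1 : e <= 1 by rewrite ge_min lexx.
  have e2 : 2 * e <= eps * lam (ib b) b ^+ 2.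
    by rewrite mulrC -ler_pdivlMr// ge_min lexx orbT.
  have [T hT] := ev_and
    (best_le_rest k_gt1 lam_gt0 N_gt0 N_unb N_step N_leS N_le_incr b e0 e1)
    (rest_le_best k_gt1 lam_gt0 N_gt0 N_unb N_step N_leS N_le_incr b e0 e1).
  exists T => // t /= /hT[hA hS]; rewrite sub0r normrN.
  have n_gt0 := total_gt0R t b; set n := (Defs.total (N t))%:R in n_gt0.
  have -> : (alpha R (N t) (ib b) b / lam (ib b) b) ^+ 2 -
      \sum_(j | j != ib b) (alpha R (N t) j b / lam j b) ^+ 2 =
      (best_sq lam ib N t b - rest_sq lam ib N t b) / n ^+ 2.
    rewrite mulrBl mulr_suml; congr (_ - _).
      by rewrite /best_sq /alpha -/n mulrAC [LHS]expr_div_n.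
    by apply: eq_bigr => j _; rewrite /alpha -/n mulrAC [LHS]expr_div_n.
  rewrite normrM normfV [`|n ^+ 2|]ger0_norm ?sqr_ge0// ler_pdivrMr ?exprn_gt0//.
  have A_n : best_sq lam ib N t b * lam (ib b) b ^+ 2 <= n ^+ 2.
    rewrite /best_sq expr_div_n divfK ?gt_eqF ?exprn_gt0//.
    by rewrite ler_sqr ?nnegrE ?ler0n// ler_nat count_le_total.
  have A0 : 0 <= best_sq lam ib N t b by rewrite sqr_ge0.
  move: hA hS A_n A0; set A := best_sq _ _ _ _ _; set S := rest_sq _ _ _ _ _ => hA hS A_n A0.
  have S0 : 0 <= S by apply: sumr_ge0 => j _; rewrite sqr_ge0.
  have dAS : `|A - S| <= 2 * e * A.
    have eA : e * A <= A by rewrite ler_piMl.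
    have eA0 : 0 <= e * A by rewrite mulr_ge0// ltW.
    have eS : e * S <= e * ((1 + e) * A) by rewrite ler_pM2l.
    have eeA : e * (e * A) <= e * A by rewrite ler_pM2l.
    by rewrite ler_norml; apply/andP; split; lra.
  apply: (le_trans dAS); apply: (@le_trans _ _ (eps * lam (ib b) b ^+ 2 * A)).
    by rewrite ler_wpM2r.
  by rewrite -mulrA ler_pM2l// mulrC.
- move=> i b j c; rewrite !inDomE => ibb jc.
  apply/cvgrPdist_le => eps eps0.
  (* For [e <= 1] the cube is at most [1 + 7 * e]. Balance is used in both directions. *)
  pose e := Num.min 1 (eps / 7).
  have e0 : 0 < e by rewrite lt_min ltr01 divr_gt0.
  have e1 : e <= 1 by rewrite ge_min lexx.
  have e2 : 7 * e <= eps by rewrite mulrC -ler_pdivlMr// ge_min lexx orbT.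
  have e3 : (1 + e) ^+ 3 <= 1 + 7 * e.
    have -> : (1 + e) ^+ 3 = 1 + e * (3 + 3 * e + e * e) by ring.
    rewrite lerD2l mulrC ler_pM2r//.
    have : e * e <= e by rewrite ler_piMl// ltW.
    lra.
  have [T hT] := wrate_balanced k_gt1 lam_gt0 N_gt0 N_unb N_step N_leS N_le_incr
    kap_lim_gt0 kap_t_cvg e0 e1.
  have [T2 hT2] := kap_ratio kap_lim_gt0 kap_t_cvg e0 e1.
  exists (maxn T0 (maxn T T2)) => // t /=; rewrite !geq_max => /and3P[T0t Tt T2t].
  have [GW _] := hT0 t T0t.
  have V0 u v : u != ib v -> 0 < wrate lam ib N kap_t t u v.
    move=> uv; have [k0 _ _] := hT2 t t u v T2t T2t uv.
    by rewrite divr_gt0// addr_gt0// uvar_gt0.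
  have n0' := total_gt0R t b.
  have red u v : W u v * G lam obs (N t) u v = wrate lam ib N kap_t t u v / (Defs.total (N t))%:R.
    by rewrite GW mulrCA mulrA divfK// gt_eqF// W_gt0.
  have Vx := V0 i b ibb; have Vy := V0 j c jc.
  have h1 := hT t Tt i b j c ibb jc; have h2 := hT t Tt j c i b jc ibb.
  rewrite !red -mulf_div divff ?gt_eqF// ?invr_gt0// mulr1.
  move: Vx Vy h1 h2; set vx := wrate _ _ _ _ _ _ _; set vy := wrate _ _ _ _ _ _ _ => Vx Vy h1 h2.
  have -> : 1 - vx / vy = (vy - vx) / vy by rewrite mulrBl divff ?gt_eqF.
  rewrite normrM normfV [`|vy|]gtr0_norm// ler_pdivrMr//.
  have h1' : vx <= (1 + 7 * e) * vy by apply: (le_trans h1); rewrite ler_pM2r.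
  have h2' : vy <= (1 + 7 * e) * vx by apply: (le_trans h2); rewrite ler_pM2r.
  have h3 : 7 * e * vy <= eps * vy by rewrite ler_pM2r.
  rewrite ler_norml; apply/andP; split; first by lra.
  have [le|lt] := leP vy vx.
    by apply: (@le_trans _ _ 0); [rewrite subr_le0|rewrite mulr_ge0// ltW].
  have : 7 * e * vx <= 7 * e * vy by rewrite ler_pM2l ?mulr_gt0// ltW.
  lra.
- move=> i b j c.
  have [K K0 [T hT]] := counts_comparable k_gt1 lam_gt0 N_gt0 N_unb N_step N_leS N_le_incr
    kap_lim_gt0 kap_t_cvg i b j c.
  apply: (@le_lt_trans _ _ K%:E); last by rewrite ltry.
  rewrite /limn_esup /limf_esup.
  apply: (@le_trans _ _ (ereal_sup ((fun t => ((N t i b)%:R / (N t j c)%:R : R)%:E) @` [set t | (T <= t)%N]))).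
    apply: ereal_inf_lbound; exists [set t | (T <= t)%N] => //.
    by exists T.
  apply: ge_ereal_sup => _ [t /= Tt <-]; rewrite lee_fin ler_pdivrMr ?ltr0n//.
  exact: hT.
Qed.

End RunBalance.

Lemma ae_countable {d : measure_display} {Omega : measurableType d} {R : realType}
    (P : probability Omega R) (T : countType) (Q : T -> Omega -> Prop) :
  (forall x, {ae P, forall w, Q x w}) -> {ae P, forall w, forall x, Q x w}.
Proof.
move=> hQ.
have : {ae P, forall w, forall n : nat, if unpickle n is Some x then Q x w else True}.
  by apply: ae_foralln => n; case: unpickle => [x|]; [exact: hQ|apply: aeW].
by apply: filterS => w h x; have := h (pickle x); rewrite pickleK.
Qed.

Lemma smean_csum {R : realType} {k B : nat} {d : measure_display} {Omega : measurableType d}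
    (Y : 'I_k -> 'I_B -> nat -> Omega -> R) i b (m : R) n w : (0 < n)%N ->
  smean (fun i b m => Y i b m w) i b n - m =
  csum (fun x : 'I_k * 'I_B * nat => Y x.1.1 x.1.2 x.2) (fun l => (i, b, l)) m 0 n w / n%:R.
Proof.
move=> n0; rewrite /smean /csum big_mkord sumrB sumr_const card_ord -[m *+ n]mulr_natr.
by rewrite mulrBl mulfK// pnatr_eq0 -lt0n.
Qed.

Theorem theorem6 (R : realType) (d : measure_display) (Omega : measurableType d)
  (P : probability Omega R) (k B : nat) (p : 'I_B -> R) (y lam : 'I_k -> 'I_B -> R)
  (n0 : nat) (Y : 'I_k -> 'I_B -> nat -> {RV P >-> R})
  (ib : 'I_B -> 'I_k) (istar : 'I_k) :
  (2 <= k)%N -> (0 < n0)%N ->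
  (forall b, 0 < p b) -> \sum_(b < B) p b = 1 ->
  (forall i b, 0 < lam i b) ->
  (* Y i b m = m-th replication at (i, theta_b): i.i.d. N(y_i(theta_b), lam_i(theta_b)^2),
     all mutually independent *)
  (forall i b m (A : set R), measurable A ->
     P (Y i b m @^-1` A) = normal_prob (y i b) (lam i b) A) ->
  mutually_independent P (fun x : 'I_k * 'I_B * nat => (Y x.1.1 x.1.2 x.2 : Omega -> R)) ->
  (* i^b is the unique conditional optimum *)
  (forall b j, j != ib b -> y (ib b) b < y j b) ->
  (* i* is the unique most probable best *)
  (forall j, j != istar -> mass p ib j < mass p ib istar) ->
  forall acc : bool,
  {ae P, forall w : Omega,
    let N := run p lam acc n0 (fun i b m => Y i b m w) in
    [/\ (forall b : 'I_B,
           (fun t => (alpha R (N t) (ib b) b / lam (ib b) b) ^+ 2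
                     - \sum_(j | j != ib b) (alpha R (N t) j b / lam j b) ^+ 2)
           @ \oo --> (0 : R)),
        (forall (i : 'I_k) (b : 'I_B) (j : 'I_k) (c : 'I_B),
           inDom ib istar i b -> inDom ib istar j c ->
           (fun t => (Wrule p ib istar acc i b * G lam (fun i b m => Y i b m w) (N t) i b)
                   / (Wrule p ib istar acc j c * G lam (fun i b m => Y i b m w) (N t) j c))
           @ \oo --> (1 : R))
      & (forall (i : 'I_k) (b : 'I_B) (j : 'I_k) (c : 'I_B), (i, b) != (j, c) ->
           (limn_esup (fun t => ((N t i b)%:R / (N t j c)%:R : R)%:E) < +oo)%E)]}.
Proof.
move=> k1 n0_gt0 p_gt0 p_sum lam_gt0 lawY indY ib_uniq istar_uniq acc.
pose X (x : 'I_k * 'I_B * nat) : Omega -> R := Y x.1.1 x.1.2 x.2.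
have mX x : measurable_fun setT (X x) by exact: measurable_funPT.
have idx_inj (i : 'I_k) (b : 'I_B) : injective (fun m : nat => (i, b, m)) by move=> m n [].
have slln_ae : {ae P, forall w, forall x : 'I_k * 'I_B, forall q : nat, exists m, forall n,
    (m <= n)%N -> `|csum X (fun l => (x.1, x.2, l)) (y x.1 x.2) 0 n w| <= q.+1%:R^-1 * n%:R}.
  apply: ae_countable => -[i b].
  by apply: (csum_slln mX indY (idx_inj i b) (lam_gt0 i b)) => m A; exact: lawY.
(* Pairs and integer parameters are countable, so a single null set serves all of them. The
   competitors of [i] are the other solutions in the same context. *)
have dom_ae : {ae P, forall w, forall x : 'I_k * 'I_B, forall La q nu0 : nat,
    exists nu, (nu0 < nu)%N /\ forall (j : {j : 'I_k | j != x.1}) n, (nu <= q * n)%N ->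
    La%:R / Num.sqrt nu%:R + csum X (fun l => (val j, x.2, l)) (y (val j) x.2) 0 n w / n%:R <=
    csum X (fun l => (x.1, x.2, l)) (y x.1 x.2) 0 nu w / nu%:R}.
  apply: ae_countable => -[i b] /=.
  apply: (@ae_dominating _ _ _ P _ X mX indY (fun l => (i, b, l)) (y i b) (lam i b) _ _ _
    _ (fun (j : {j : 'I_k | j != i}) l => (val j, b, l)) (fun j => y (val j) b) (fun j => lam (val j) b)) => //.
  - by move=> m A; exact: lawY.
  - by move=> j m A; exact: lawY.
  - by move=> [j ji] m n /=; apply: contra ji => /eqP[->].
apply: filterS2 slln_ae dom_ae => w slln dom.
pose obs i b m := Y i b m w.
have slln' i b (e : R) : 0 < e -> exists m, forall n, (m <= n)%N -> `|smean obs i b n - y i b| <= e.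
  move=> e0; pose q := Num.truncn e^-1.
  have [m hm] := slln (i, b) q; exists m.+1 => n mn.
  have n_gt0 : (0 < n)%N by exact: leq_ltn_trans mn.
  have nR : 0 < n%:R :> R by rewrite ltr0n.
  rewrite (smean_csum Y)// normrM normfV [`|n%:R|]gtr0_norm// ler_pdivrMr//.
  apply: (le_trans (hm n (ltnW mn))); rewrite ler_pM2r//.
  by rewrite ltW// invf_plt ?posrE// Num.Theory.truncnS_gt.
have dom' i b (La q nu0 : nat) : exists nu, (nu0 < nu)%N /\
    forall j, j != i -> forall n, (nu <= q * n)%N ->
      La%:R / Num.sqrt nu%:R + (smean obs j b n - y j b) <= smean obs i b nu - y i b.
  have [nu [nunu0 hnu]] := dom (i, b) La q nu0.
  exists nu; split => // j ji n nuq.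
  have nu_gt0 : (0 < nu)%N by exact: leq_ltn_trans nunu0.
  have n_gt0 : (0 < n)%N by case: n nuq => //; rewrite muln0 leqNgt nu_gt0.
  by rewrite !(smean_csum Y)//; exact: (hnu (exist _ j ji) n nuq).
have [h1 h2 h3] := run_balance acc k1 n0_gt0 p_gt0 p_sum lam_gt0 ib_uniq istar_uniq slln' dom'.
by split => // i b j c _; exact: h3.
Qed.
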